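(* Let $C \in \mathbb{R} \cap [0,\frac{1}{2}]$ be given. There exists a regular local ring $(R,\mathfrak{m}_R)$ of dimension $2$ and a discrete, rank $1$ valuation $\nu$ of the quotient field of $R$ dominating $R$, such that each of the functions $n\mapsto\ell_R(R/I_n)$ and $n\mapsto\ell_R(I_n/I_{n+1})$ is not a quasi-polynomial plus a bounded function for large integers $n$, and such that $$\lim_{n \rightarrow \infty} \frac{\ell_R(I_n/I_{n+1})}{n} = C \quad\text{and}\quad \lim_{n \rightarrow \infty} \frac{\ell_R(R/I_{n})}{n^2} = \frac{C}{2}.$$
   Context: A valuation $\nu$ of the quotient field $K$ of $R$ has valuation ring $V_{\nu}=\{f\in K\mid \nu(f)\ge 0\}$ with maximal ideal $\mathfrak{m}_{\nu}=\{f\in K\mid \nu(f)>0\}$; it dominates $R$ if $R\subset V_{\nu}$ and $R\cap\mathfrak{m}_{\nu}=\mathfrak{m}_R$. It is discrete (of rank 1) if its value group is order isomorphic to $\mathbb{Z}$, and the value group is then identified with $\mathbb{Z}$. For $n\in\mathbb{Z}_{\ge 0}$, $I_n=\{f\in R\mid \nu(f)\ge n\}$. $\ell_R$ denotes length as an $R$-module. A quasi-polynomial in $n$ is an expression $a_d(n)n^d+a_{d-1}(n)n^{d-1}+\dots+a_1(n)n+a_0(n)$ whose coefficients $a_0(n),\dots,a_d(n)$ are (real-valued) periodic functions of the integer $n$, with integral period. A function $f$ is ''a quasi-polynomial plus a bounded function for large integers $n$'' if there are a quasi-polynomial $Q(n)$, a bounded function $\sigma(n)$ and an integer $n_0$ with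 $f(n)=Q(n)+\sigma(n)$ for all integers $n\ge n_0$. *)

(* Defs.v *)
From HB Require Import structures.
From mathcomp Require Import all_boot all_order all_algebra.
From mathcomp Require Import fraction ring_quotient generic_quotient.
From mathcomp Require Import all_classical all_reals all_analysis.

Set Implicit Arguments.
Unset Strict Implicit.
Unset Printing Implicit Defensive.

Import Order.TTheory GRing.Theory Num.Theory.
Import numFieldNormedType.Exports.

Local Open Scope classical_set_scope.
Local Open Scope quotient_scope.
Local Open Scope ring_scope.

(* The quotient module V / N of a module V by a submodule N: the quotient group
   Quotient.quot, with the induced scaling. *)
Section QuotientModule.
Variables (A : pzRingType) (V : lmodType A) (N : submodClosed V).

Fact submod_zmod_closed : zmod_closed N.
Proof. exact: submodClosedP. Qed.

Definition submod_zmod : zmodClosed V :=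
  HB.pack (GRing.SubmodClosed.sort N)
    (GRing.isZmodClosed.Build V (GRing.SubmodClosed.sort N) submod_zmod_closed).

Definition quotmod : Type := Quotient.quot submod_zmod.

HB.instance Definition _ := GRing.Zmodule.on quotmod.
HB.instance Definition _ : EqQuotient V (Quotient.equiv submod_zmod) quotmod :=
  EqQuotient.on quotmod.
HB.instance Definition _ := ZmodQuotient.on quotmod.

Definition quotmod_scale (a : A) (x : quotmod) : quotmod :=
  \pi_quotmod (a *: repr x).

Lemma pi_quotmod_eq (u v : V) :
  (\pi_quotmod u == \pi_quotmod v) = (u - v \in N).
Proof. exact/esym/(Quotient.idealrBE submod_zmod). Qed.

Lemma pi_quotmodZ a (v : V) :
  \pi_quotmod (a *: v) = quotmod_scale a (\pi_quotmod v).
Proof.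
apply/eqP; rewrite pi_quotmod_eq -scalerBr rpredZ //.
by rewrite -pi_quotmod_eq reprK.
Qed.

Fact quotmod_scaleA a b x :
  quotmod_scale a (quotmod_scale b x) = quotmod_scale (a * b) x.
Proof.
by rewrite -[x]reprK -(pi_quotmodZ b (repr x)) -!pi_quotmodZ scalerA.
Qed.

Fact quotmod_scale1r : left_id 1 quotmod_scale.
Proof. by move=> x; rewrite -[x]reprK -pi_quotmodZ scale1r. Qed.

Fact quotmod_scaleDr : right_distributive quotmod_scale +%R.
Proof.
move=> a x y; rewrite -[x]reprK -[y]reprK -raddfD -!pi_quotmodZ.
by rewrite scalerDr raddfD.
Qed.

Fact quotmod_scaleDl x : {morph quotmod_scale^~ x : a b / a + b}.
Proof.
by move=> a b; rewrite -[x]reprK -!pi_quotmodZ scalerDl raddfD.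
Qed.

HB.instance Definition _ := GRing.Zmodule_isLmodule.Build A quotmod
  quotmod_scaleA quotmod_scale1r quotmod_scaleDr
  quotmod_scaleDl.

End QuotientModule.

Definition chain_lengths (T : Type) (P : set (set T)) : set nat :=
  [set n | exists N : nat -> set T,
     (forall i, (i <= n)%N -> P (N i)) /\
     (forall i, (i < n)%N -> N i `<` N i.+1)].

Definition submodule (A : pzRingType) (V : lmodType A) (N : set V) : Prop :=
  submod_closed [in N].

(* The length of the submodule W of V: its submodules are the submodules of V
   that are contained in W. *)
Definition module_length (R : realType) (A : pzRingType) (V : lmodType A)
    (W : set V) : \bar R :=
  ereal_sup [set n%:R%:E | n in
    chain_lengths [set N : set V | submodule N /\ N `<=` W]].

Section RegularLocalRing.
Variable A : comNzRingType.

Definition ideal (I : set A) : Prop := submodule (I : set A^o).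

Definition ideal_gen (s : seq A) : set A :=
  [set x | exists c : 'I_(size s) -> A, x = \sum_(i < size s) c i * s`_i].

Definition noetherian_ring : Prop :=
  forall I : set A, ideal I -> exists s : seq A, I = ideal_gen s.

(* idealr_closed includes properness: 1 is not in the ideal. *)
Definition prime_ideal (P : set A) : Prop :=
  idealr_closed [in P] /\ prime_idealr_closed [in P].

Definition maximal_ideal (m : set A) : Prop :=
  idealr_closed [in m] /\
  forall I : set A, idealr_closed [in I] -> m `<=` I -> I = m.

Definition has_krull_dim (d : nat) : Prop :=
  chain_lengths prime_ideal d /\
  forall n, chain_lengths prime_ideal n -> (n <= d)%N.

Definition local_ring (m : set A) : Prop :=
  maximal_ideal m /\ forall m' : set A, maximal_ideal m' -> m' = m.

Definition regular_local_ring (m : set A) (d : nat) : Prop :=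
  [/\ noetherian_ring, local_ring m, has_krull_dim d
    & exists s : d.-tuple A, m = ideal_gen s].

End RegularLocalRing.

(* The value group is identified with the integers, so that the valuation takes
   every integer value on nonzero elements; the value of 0 is +oo. *)
Record discrete_valuation (K : fieldType) := DiscreteValuation {
  dval :> K -> \bar int;
  dval0 : dval 0 = +oo%E;
  dval_fin_num : forall x, x != 0 -> dval x \is a fin_num;
  dvalM : forall x y, dval (x * y) = (dval x + dval y)%E;
  dvalD : forall x y, (Order.min (dval x) (dval y) <= dval (x + y))%E;
  dval_surj : forall k : int, exists x, dval x = k%:E }.

Definition valuation_ring (K : fieldType) (nu : discrete_valuation K) : set K :=
  [set x | (0 <= nu x)%E].

Definition valuation_ideal (K : fieldType) (nu : discrete_valuation K) : set K :=
  [set x | (0 < nu x)%E].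

Definition dominates (A : idomainType) (m : set A)
    (nu : discrete_valuation {fraction A}) : Prop :=
  range (@tofrac A) `<=` valuation_ring nu /\
  @tofrac A @^-1` valuation_ideal nu = m.

Section ValueIdeals.
Variables (A : idomainType) (m : set A) (nu : discrete_valuation {fraction A}).
Variable dom : dominates m nu.

(* The domination hypothesis is what makes this an ideal; it is recorded in the
   term so that the ideal structure below can be inferred. *)
Definition value_ideal of dominates m nu := fun n : nat =>
  (fun f => (n%:Z%:E <= nu (@tofrac A f))%E) : {pred A^o}.

Local Notation I n := (value_ideal dom n).

Fact value_ideal_submod_closed n : submod_closed (I n).
Proof.
split=> [|a u v]; rewrite !unfold_in ?raddf0 ?dval0 ?leey // => hu hv.
rewrite [tofrac _](rmorphD (@tofrac A) (a * (u : A)) v) rmorphM.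
apply: le_trans (dvalD _ _ _).
rewrite le_min hv andbT dvalM -[leLHS]add0e leeD //.
by apply: dom.1; exists a.
Qed.

HB.instance Definition _ n := GRing.isSubmodClosed.Build A A^o
  (value_ideal dom n) (value_ideal_submod_closed n).

Definition length_quotient (R : realType) (n : nat) : \bar R :=
  module_length R [set: quotmod (I n)].

(* I_n / I_(n+1), as the image of I_n in A / I_(n+1). *)
Definition length_graded (R : realType) (n : nat) : \bar R :=
  module_length R (\pi_(quotmod (I n.+1)) @` [set` I n]).

End ValueIdeals.

Definition quasi_polynomial (R : realType) (Q : int -> R) : Prop :=
  exists (d : nat) (a : nat -> int -> R),
    (forall i, (i <= d)%N -> exists2 p : int, 0 < p & periodic (a i) p) /\
    (forall n : int, Q n = \sum_(i < d.+1) a i n * n%:~R ^+ i).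

Definition quasi_polynomial_plus_bounded (R : realType) (f : nat -> \bar R) :
    Prop :=
  exists (Q : int -> R) (sigma : int -> R) (n0 : nat),
    [/\ quasi_polynomial Q, bounded_fun sigma
      & forall n : nat, (n0 <= n)%N -> f n = (Q n%:Z + sigma n%:Z)%:E].

(* Main.v *)
(* Let k = Q and let A be the localization of k[x, y] at (x, y). Choose distinct primes u_i
   and integers b_0 > 0, b_(i+1) > 2 b_i, and put P_0 = y,
   P_(i+1) = P_i^2 - u_i x^(2 b_i). The products Q_m of the P_i over the binary digits of m
   are monic of degree m in y, hence form a basis over k[x]. MacLane's recipe gives a
   discrete valuation with nu(x) = 1 and nu(P_i) = b_i: the residue of P_i / x^(b_i) is
   sqrt u_i, the value of a polynomial is the least value of the terms of its expansion
   along the Q_m, and leading forms multiply because the products of the sqrt u_i are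
   linearly independent over Q. So I_n / I_(n+1) has a k-basis indexed by the m with
   w(m) = nu(Q_m) <= n, and its length is the number D(n) of these m. Since w(m) is the sum
   of the b_i over the binary digits of m, choosing b_i = floor(2^i / C) - 1 (and b_i growing
   faster than 2^i if C = 0) gives D(n) / n -> C. The error D(n) - C n is unbounded, because
   C w(m) <= m - C s(m) where s(m) is the number of binary digits 1 of m (and because D is
   unbounded if C = 0), whereas a monotone function that is a quasi-polynomial plus a bounded
   function and is C n + o(n) stays at bounded distance from C n. *)
From HB Require Import structures.
Require Import Defs.
From mathcomp Require Import all_boot all_order all_algebra.
From mathcomp Require Import fraction ring_quotient generic_quotient.
From mathcomp Require Import all_classical all_reals all_analysis.
From mathcomp Require Import ring lra zify.

Set Implicit Arguments.
Unset Strict Implicit.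
Unset Printing Implicit Defensive.

Import Order.TTheory GRing.Theory Num.Theory.
Import numFieldNormedType.Exports.

(** * Binary expansions *)

(** Dividing by x^n embeds I_n / I_(n+1) in the residue field of the valuation, so lengths that grow
    without bound force this field to be infinite over k; hence the infinitely many independent
    square roots. The residue field itself is not built: the roots are taken in the real numbers,
    and for f of value at least n the form [lam n f] is the real number that stands for the class of
    f / x^n. The crux is the carry. A product of two basis elements may repeat a digit, and P_i^2
    must then be rewritten as P_(i+1) + u_i x^(2 b_i). Since b_(i+1) > 2 b_i, the first term has
    larger value and leaves the leading form, so P_i acts there as sqrt u_i. The bound C <= 1/2
    enters through the exponents: it gives floor(1/C) >= 2 for C > 0, so that b_0 stays positive
    after 1 is subtracted, and b_0 > 0 puts y in the maximal ideal of the valuation. Length is a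
    supremum over chains of submodules, so it is computed from filtrations whose steps are
    one-dimensional over k, together with a bound on all competing chains. *)

Definition bit (m i : nat) : bool := odd (m %/ 2 ^ i).

Lemma bit0 m : bit m 0 = odd m.
Proof. by rewrite /bit expn0 divn1. Qed.

Lemma bitS m i : bit m i.+1 = bit m./2 i.
Proof. by rewrite /bit expnS divnMA divn2. Qed.

Lemma bit_small m i : m <= i -> bit m i = false.
Proof.
move=> mi; rewrite /bit divn_small //.
by apply: leq_ltn_trans mi _; apply: ltn_expl.
Qed.

Lemma bit_addn m i : ~~ bit m i -> forall j, bit (m + 2 ^ i) j = (j == i) || bit m j.
Proof.
elim: i m => [|i IH] m.
  rewrite bit0 expn0 addn1 => mE [|j]; first by rewrite !bit0 /= mE.
  by rewrite !bitS /= uphalf_half (negbTE mE).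
rewrite bitS => /IH {}IH [|j].
  by rewrite !bit0 oddD expnS mul2n odd_double addbF.
by rewrite !bitS expnS mul2n halfD odd_double andbF add0n doubleK IH.
Qed.

Section Bigbit.
Variables (T : Type) (idx : T) (op : Monoid.com_law idx).

(** Weights, key monomials and products of radicals are all instances of this one operator. The
    bound [i < m] loses no digit, since 2 ^ i > m for i >= m; [bigbit_widen] then allows any larger
    bound. *)
Definition bigbit (F : nat -> T) (m : nat) : T := \big[op/idx]_(i < m | bit m i) F i.

Lemma bigbit_widen F m n : m <= n -> bigbit F m = \big[op/idx]_(i < n | bit m i) F i.
Proof.
move=> mn; rewrite /bigbit -(big_mkord (bit m) F) -(big_mkord (bit m) F).
rewrite [RHS](big_cat_nat _ mn) //= [X in op _ X]big1_seq ?Monoid.mulm1 //.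
by move=> i /andP[bi]; rewrite mem_index_iota => /andP[mi _]; rewrite bit_small in bi.
Qed.

Lemma bigbit0 F : bigbit F 0 = idx.
Proof. by rewrite /bigbit big_ord0. Qed.

Lemma bigbit_addn F m i : ~~ bit m i -> bigbit F (m + 2 ^ i) = op (F i) (bigbit F m).
Proof.
move=> mi; have iN : i < m + 2 ^ i by rewrite ltn_addl // ltn_expl.
rewrite (bigbit_widen F (leq_addr (2 ^ i) m)) /bigbit.
rewrite (bigD1 (Ordinal iN)) /=; last by rewrite bit_addn ?eqxx.
congr (op _ _); apply: eq_bigl => j; rewrite bit_addn // -val_eqE /=.
by case: eqP => [->|_] /=; rewrite ?andbT ?andbF ?(negbTE mi).
Qed.

Lemma bigbit_half F m :
  bigbit F m = op (if odd m then F 0 else idx) (bigbit (fun i => F i.+1) m./2).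
Proof.
rewrite (bigbit_widen F (leqnSn m)) (@bigbit_widen _ _ m) ?half_leqif //; last by lia.
rewrite big_mkcond big_ord_recl /= bit0 [in RHS]big_mkcond; congr (op _ _).
by apply: eq_bigr => i _; rewrite bitS.
Qed.

Lemma bigbit_pow2 F i : bigbit F (2 ^ i) = F i.
Proof.
rewrite -[2 ^ i]add0n bigbit_addn ?bigbit0 ?Monoid.mulm1 //.
by rewrite bit_small.
Qed.

Lemma bigbit_pred_pow2 F i : bigbit F (2 ^ i).-1 = \big[op/idx]_(j < i) F j.
Proof.
elim: i F => [|i IH] F; first by rewrite bigbit0 big_ord0.
have p0 : 0 < 2 ^ i by rewrite expn_gt0.
rewrite bigbit_half big_ord_recl.
have -> : (2 ^ i.+1).-1 = ((2 ^ i).-1).*2.+1 by rewrite expnS; lia.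
by rewrite /= odd_double /= uphalf_double IH.
Qed.
End Bigbit.

Lemma bigbit_subn (m i : nat) : bit m i -> [/\ m = (m - 2 ^ i) + 2 ^ i, ~~ bit (m - 2 ^ i) i & m - 2 ^ i < m].
Proof.
move=> mi.
have le : 2 ^ i <= m.
  by rewrite leqNgt; apply/negP => lt; move: mi; rewrite /bit divn_small.
have p0 : 0 < 2 ^ i by rewrite expn_gt0.
split; [by rewrite subnK | | by lia].
move: mi; rewrite /bit -{1}(subnK le) divnDr ?dvdnn // divnn p0 oddD addbT //.
Qed.

Lemma bigbit_nat m : bigbit addn (fun i => 2 ^ i) m = m.
Proof.
elim/ltn_ind: m => -[_|m IH]; first by rewrite bigbit0.
rewrite bigbit_half.
have -> : bigbit addn (fun i => 2 ^ i.+1) m.+1./2 = 2 * bigbit addn (fun i => 2 ^ i) m.+1./2.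
  by rewrite /bigbit big_distrr /=; apply: eq_bigr => i _; rewrite expnS.
rewrite IH; last by lia.
by rewrite -[RHS]odd_double_half mul2n expn0 /=; case: (~~ _).
Qed.

(** * Weights of binary expansions and their counting function *)

Section Weight.
Variable b : nat -> nat.
Hypothesis b0_gt0 : 0 < b 0.
Hypothesis b_double : forall i, (b i).*2 < b i.+1.

Definition weight (m : nat) : nat := bigbit addn b m.

(** A carry replaces digit i by digit i.+1, and [b_double] says that this costs more than it frees.
    The induction halves m and therefore shifts the sequence, so it is run for every c with 2 c_i <=
    c_(i+1) and shows that a step gains at least c_0. *)
Lemma weight_lt m : weight m < weight m.+1.
Proof.
suff H : forall c : nat -> nat, (forall i, (c i).*2 <= c i.+1) ->
    c 0 + bigbit addn c m <= bigbit addn c m.+1.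
  by apply: leq_trans (H b (fun i => ltnW (b_double i))); rewrite -addn1 addnC leq_add2r.
elim/ltn_ind: m => m IH c hc; rewrite (bigbit_half _ _ m) (bigbit_half _ _ m.+1) /=.
rewrite uphalf_half; case: (boolP (odd m)) => /= mo; last by rewrite !add0n.
have := IH m./2; rewrite add0n add1n => /(_ _ (fun i => c i.+1)).
have mm : m./2 < m by lia.
by move=> /(_ mm (fun i => hc i.+1)); have := hc 0; lia.
Qed.

Lemma weight0 : weight 0 = 0. Proof. exact: bigbit0. Qed.

Lemma weight_mono : {mono weight : m n / m < n}.
Proof. by apply: leqW_mono; apply: leq_mono; apply: homo_ltn weight_lt; apply: ltn_trans. Qed.

Lemma leq_weight m : m <= weight m.
Proof. by elim: m => // m IH; apply: leq_ltn_trans IH (weight_lt m). Qed.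

Lemma ex_weight_gt n : exists m, n < weight m.
Proof. by exists n.+1; apply: leq_weight. Qed.

(** This is the number D(n) of the overview: as [weight] is strictly increasing, the m with
    [weight m <= n] form an initial segment, and its length is the first m that falls outside. *)
Definition wcount (n : nat) : nat := ex_minn (ex_weight_gt n).

Lemma weight_leq m n : (weight m <= n) = (m < wcount n).
Proof.
rewrite /wcount; case: ex_minnP => M nM min; apply/idP/idP => [le|].
  by rewrite -weight_mono; apply: leq_ltn_trans le nM.
by apply: contraLR; rewrite -!ltnNge ltnS; apply: min.
Qed.

Lemma wcount_weight m : wcount (weight m) = m.+1.
Proof.
apply/eqP; rewrite eqn_leq -weight_leq leqnn andbT.
by rewrite leqNgt -weight_leq -ltnNge weight_lt.
Qed.

Lemma leq_wcount m n : m <= n -> wcount m <= wcount n.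
Proof.
move=> mn; case E : (wcount m) => [//|k].
by rewrite -weight_leq (leq_trans _ mn) // weight_leq E.
Qed.

Lemma wcount_gt0 n : 0 < wcount n.
Proof. by rewrite -weight_leq weight0. Qed.
End Weight.

Local Open Scope classical_set_scope.
Local Open Scope ring_scope.

(** * Square roots of primes *)

Fixpoint prime_seq (i : nat) : nat :=
  if i is j.+1 then s2val (prime_above (prime_seq j)) else 2.

Lemma prime_prime_seq i : prime (prime_seq i).
Proof. by case: i => //= i; case: prime_above. Qed.

Lemma prime_seq_lt i j : (i < j)%N -> (prime_seq i < prime_seq j)%N.
Proof. by move: i j; apply: (homo_ltn ltn_trans) => i /=; case: prime_above. Qed.

Section Radicals.
Variable R : rcfType.

Definition radical (i : nat) : R := Num.sqrt (prime_seq i)%:R.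

Lemma radical_sqr i : radical i ^+ 2 = ratr (prime_seq i)%:R.
Proof. by rewrite sqr_sqrtr ?ler0n // ratr_nat. Qed.

(** The field generated over the rationals by the first n radicals, as a tower of quadratic steps.
    Closure under inverses is not evident from this form and needs that each step is proper. *)
Fixpoint radical_field (n : nat) (x : R) : Prop :=
  if n is k.+1 then
    exists a b, [/\ radical_field k a, radical_field k b & x = a + b * radical k]
  else exists c : rat, x = ratr c.

Local Notation F := radical_field.

Lemma radical_field_rat n c : F n (ratr c).
Proof.
elim: n c => [|n IH] c; first by exists c.
by exists (ratr c), (ratr 0); split=> //; rewrite raddf0 mul0r addr0.
Qed.

Lemma radical_fieldD n x y : F n x -> F n y -> F n (x + y).
Proof.
elim: n x y => [|n IH] x y /=; first by move=> [c ->] [d ->]; exists (c + d); rewrite rmorphD.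
move=> [a [b [Fa Fb ->]]] [c [d [Fc Fd ->]]]; exists (a + c), (b + d).
by split; [exact: IH | exact: IH | ring].
Qed.

Lemma radical_fieldM n x y : F n x -> F n y -> F n (x * y).
Proof.
elim: n x y => [|n IH] x y /=; first by move=> [c ->] [d ->]; exists (c * d); rewrite rmorphM.
move=> [a [b [Fa Fb ->]]] [c [d [Fc Fd ->]]].
exists (a * c + b * d * ratr (prime_seq n)%:R), (a * d + b * c); split.
- apply: radical_fieldD; first exact: IH.
  by apply: (IH); [exact: (IH) | exact: radical_field_rat].
- by apply: radical_fieldD; exact: (IH).
by rewrite -radical_sqr; ring.
Qed.

Lemma radical_fieldN n x : F n x -> F n (- x).
Proof.
by move=> Fx; rewrite -mulN1r -(rmorphN1 (@ratr R)); apply: radical_fieldM => //; exact: radical_field_rat.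
Qed.

(** A piece of Kummer theory: up to rational factors, the only square roots of rationals in the n-th
    field are the evident products of radicals. *)
Let sqrt_in n := forall x c, F n x -> x ^+ 2 = ratr c ->
  exists (r : rat) (S : pred nat), x = ratr r * \prod_(i < n | S i) radical i.

Let inv_in n := forall x, F n x -> F n x^-1.

(** Otherwise the n-th prime is a rational square times a product of smaller primes. After clearing
    denominators, it divides one side to an odd power and the other to an even power. *)
Let radical_notin_of_sqrt n : sqrt_in n -> ~ F n (radical n).
Proof.
move=> sq Fr; have [r [S E]] := sq _ _ Fr (radical_sqr n).
have {E} E : ((prime_seq n)%:R : rat) = r ^+ 2 * (\prod_(i < n | S i) prime_seq i)%:R.
  apply: (fmorph_inj (@ratr R)); rewrite /= -radical_sqr E exprMn rmorphM rmorphXn.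
  congr (_ * _); rewrite rmorph_nat natr_prod -prodrXl; apply: eq_bigr => i _.
  by rewrite radical_sqr ratr_nat.
set q := (\prod_(i < n | S i) prime_seq i)%N in E.
have dr : (denq r)%:~R != 0 :> rat by rewrite intr_eq0 denq_eq0.
have {E} : ((prime_seq n * `|denq r| ^ 2 = `|numq r| ^ 2 * q)%N).
  apply/eqP; rewrite -(eqr_nat rat) natrM natrX (natrM _ (_ ^ 2)%N) natrX !natr_absz.
  rewrite !intr_norm !real_normK ?num_real // E -[in X in X ^+ 2 * _ * _](divq_num_den r).
  by apply/eqP; field.
have p0 := prime_gt0 (prime_prime_seq n).
have q0 : (0 < q)%N by apply: prodn_cond_gt0 => i _; apply: prime_gt0 (prime_prime_seq i).
have d0 : (0 < `|denq r|)%N by rewrite absz_gt0 denq_eq0.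
have qp : logn (prime_seq n) q = 0%N.
  apply/eqP; rewrite lognE prime_prime_seq q0 /=; case: ifP => // dv.
  exfalso; move: dv; rewrite Euclid_dvd_prod ?prime_prime_seq // big_orE => /existsP[i /andP[_]].
  rewrite dvdn_prime2 ?prime_prime_seq // => /eqP E.
  by have := prime_seq_lt (ltn_ord i); rewrite -E ltnn.
have [n0|n0] := posnP `|numq r|%N.
  move/eqP; rewrite n0 exp0n // mul0n muln_eq0 expn_eq0.
  by rewrite !gtn_eqF.
move/(congr1 (logn (prime_seq n))); rewrite lognM ?expn_gt0 ?d0 // lognX (lognM _ _ q0) ?expn_gt0 ?n0 // lognX qp logn_prime ?prime_prime_seq //.
by move=> /(congr1 odd); rewrite addn0 oddD !oddM eqxx.
Qed.

(* Inverting a + b * radical n requires that radical n is not in the n-th field, which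
   follows from [sqrt_in n]; and the induction step for [sqrt_in] requires inverses. *)
Let radical_field_ind n : inv_in n /\ sqrt_in n.
Proof.
elim: n => [|n [inv sq]].
  split=> [x [c ->]|x c [d ->] _]; first by exists c^-1; rewrite fmorphV.
  by exists d, xpredT; rewrite big_ord0 mulr1.
have nr := radical_notin_of_sqrt sq.
split=> [x [a [b [Fa Fb ->]]]|x c [a [b [Fa Fb ->]]]].
  have [->|b0] := eqVneq b 0.
    by exists a^-1, 0; split; [exact: inv | rewrite -(raddf0 (@ratr R)); exact: radical_field_rat |rewrite !mul0r !addr0].
  set d := a ^+ 2 - b ^+ 2 * ratr (prime_seq n)%:R.
  have Fd : F n d^-1.
    apply: inv; apply: radical_fieldD; first exact: radical_fieldM.
    apply: radical_fieldN; apply: radical_fieldM; first exact: radical_fieldM.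
    exact: radical_field_rat.
  have dE : d = (a + b * radical n) * (a - b * radical n) by rewrite /d -radical_sqr; ring.
  have d1 : a + b * radical n != 0.
    apply/eqP => E; apply: nr; have -> : radical n = - a * b^-1.
      by apply: (mulIf b0); rewrite mulfVK //; move/eqP: E; rewrite addrC addr_eq0 => /eqP <-; ring.
    by apply: radical_fieldM; [exact: radical_fieldN|exact: inv].
  have d2 : a - b * radical n != 0.
    apply/eqP => E; apply: nr; have -> : radical n = a * b^-1.
      by apply: (mulIf b0); rewrite mulfVK //; move/eqP: E; rewrite subr_eq0 => /eqP ->; ring.
    by apply: radical_fieldM; [exact: Fa|exact: inv].
  exists (a * d^-1), (- b * d^-1); split.
  - exact: radical_fieldM.
  - by apply: radical_fieldM => //; exact: radical_fieldN.
  by rewrite dE; field; rewrite d1 d2.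
move=> E.
have [b0|b0] := eqVneq b 0.
  have [r [S aE]] : exists (r : rat) (S : pred nat), a = ratr r * \prod_(i < n | S i) radical i.
    by apply: (sq a c) => //; rewrite -E b0 mul0r addr0.
  exists r, [pred i | S i && (i != n)].
  rewrite big_mkcond big_ord_recr /= eqxx andbF mulr1 b0 mul0r addr0 aE [in LHS]big_mkcond.
  by congr (_ * _); apply: eq_bigr => i _; rewrite ltn_eqF // andbT.
have [a0|a0] := eqVneq a 0.
  have pn : (prime_seq n)%:R != 0 :> rat by rewrite pnatr_eq0 -lt0n prime_gt0 ?prime_prime_seq.
  have [] := sq b (c / (prime_seq n)%:R) Fb.
    rewrite fmorph_div /= -E a0 add0r exprMn radical_sqr mulfK //.
    by rewrite fmorph_eq0.
  move=> r [S bE]; exists r, [pred i | S i || (i == n)].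
  rewrite big_mkcond big_ord_recr /= eqxx orbT a0 add0r bE [in LHS]big_mkcond -mulrA; congr (_ * (_ * _)).
  by apply: eq_bigr => i _; rewrite ltn_eqF // orbF.
(* With a and b both nonzero, expanding (a + b * radical n)^2 = c and dividing by 2ab expresses
   [radical n] in the n-th field. *)
exfalso; apply: nr.
have -> : radical n = (ratr c + (- (a * a + b * b * ratr (prime_seq n)%:R))) * (ratr 2 * (a * b))^-1.
  rewrite -E -radical_sqr rmorph_nat; field.
  by rewrite a0 b0.
apply: radical_fieldM.
  apply: radical_fieldD; first exact: radical_field_rat.
  apply: radical_fieldN; apply: radical_fieldD; first exact: radical_fieldM.
  by apply: radical_fieldM; [exact: radical_fieldM|exact: radical_field_rat].
by apply: inv; apply: radical_fieldM; [exact: radical_field_rat|exact: radical_fieldM].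
Qed.

Lemma radical_notin n : ~ F n (radical n).
Proof. exact: radical_notin_of_sqrt (radical_field_ind n).2. Qed.

Definition radical_prod (m : nat) : R := bigbit *%R radical m.

Lemma radical_prod_split n (c : nat -> rat) :
  \sum_(m < 2 ^ n.+1) ratr (c m) * radical_prod m =
  \sum_(m < 2 ^ n) ratr (c m) * radical_prod m +
  (\sum_(m < 2 ^ n) ratr (c (m + 2 ^ n)%N) * radical_prod m) * radical n.
Proof.
rewrite -(big_mkord xpredT (fun m => ratr (c m) * radical_prod m)).
rewrite (@big_cat_nat _ _ _ (2 ^ n)) //=; last by rewrite leq_exp2l.
rewrite !big_mkord; congr (_ + _); rewrite -{1}[(2 ^ n)%N]add0n big_addn.
rewrite expnS mul2n -addnn addnK big_mkord big_distrl /=; apply: eq_bigr => i _.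
by rewrite /radical_prod bigbit_addn /= ?[radical n * _]mulrC ?mulrA // /bit divn_small.
Qed.

Lemma radical_prod_in n (c : nat -> rat) :
  F n (\sum_(m < 2 ^ n) ratr (c m) * radical_prod m).
Proof.
elim: n c => [|n IH] c; last first.
  rewrite radical_prod_split.
  exact: (ex_intro _ _ (ex_intro _ _ (And3 (IH c) (IH (fun m => c (m + 2 ^ n)%N)) erefl))).
by exists (c 0%N); rewrite big_ord1 /radical_prod bigbit0 mulr1.
Qed.

(** Padding with zeros brings the range to a power of 2. The top digit then splits the sum as a + b
    * radical n with a and b in the n-th field; a nonzero b would put [radical n] there, so a = b =
    0 and the induction applies to both halves. *)
Lemma radical_prod_free N (c : nat -> rat) :
  \sum_(m < N) ratr (c m) * radical_prod m = 0 -> forall m, (m < N)%N -> c m = 0.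
Proof.
suff H n (d : nat -> rat) : \sum_(m < 2 ^ n) ratr (d m) * radical_prod m = 0 ->
    forall m, (m < 2 ^ n)%N -> d m = 0.
  move=> E m mN; pose d i := if (i < N)%N then c i else 0.
  have dm : d m = 0.
    apply: (H N); last by apply: ltn_trans mN (ltn_expl _ _).
    rewrite -[RHS]E -(big_mkord xpredT (fun m => ratr (d m) * radical_prod m)).
    rewrite (@big_cat_nat _ _ _ N) //=; last by rewrite ltnW // ltn_expl.
    rewrite [X in _ + X]big1_seq ?addr0; last first.
      move=> i /andP[_]; rewrite mem_index_iota => /andP[Ni _].
      by rewrite /d ltnNge Ni /= raddf0 mul0r.
    by rewrite big_mkord; apply: eq_bigr => i _; rewrite /d ltn_ord.
  by move: dm; rewrite /d mN.
elim: n d => [|n IH] d.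
  rewrite big_ord1 /radical_prod bigbit0 mulr1 => /eqP; rewrite fmorph_eq0 => /eqP d0 m.
  by rewrite expn0 ltnS leqn0 => /eqP ->.
rewrite radical_prod_split; set a := (X in X + _); set b := (X in _ + X * _) => E.
have Fa : F n a := radical_prod_in n d.
have Fb : F n b := radical_prod_in n (fun m => d (m + 2 ^ n)%N).
have b0 : b = 0.
  apply/eqP/negPn/negP => b0; apply: (@radical_notin n).
  have -> : radical n = - a * b^-1.
    by apply: (mulIf b0); rewrite mulfVK //; move/eqP: E; rewrite addrC addr_eq0 => /eqP <-; ring.
  by apply: radical_fieldM; [exact: radical_fieldN|exact: (radical_field_ind n).1].
have a0 : a = 0 by move: E; rewrite b0 mul0r addr0.
move=> m; have [mn _|nm] := ltnP m (2 ^ n); first exact: IH a0 m mn.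
rewrite expnS mul2n -addnn => mlt; rewrite -(subnK nm).
by apply: (IH (fun m => d (m + 2 ^ n)%N)) => //; rewrite ltn_subLR.
Qed.

End Radicals.

(** * The valuation on polynomials *)

Lemma bit_ind (P : nat -> Prop) :
  P 0%N -> (forall m i, ~~ bit m i -> P m -> P (m + 2 ^ i)%N) -> forall m, P m.
Proof.
move=> P0 PS; elim/ltn_ind => m IH.
have [i mi|mN] := pickP (fun i : 'I_m => bit m i).
  by have [E nb lt] := bigbit_subn mi; rewrite E; apply: PS => //; exact: IH.
have -> // : m = 0%N by rewrite -(bigbit_nat m) /bigbit big1 // => i; rewrite mN.
Qed.

Lemma poly_split (A : nzRingType) (p : {poly A}) : p = (p`_0)%:P + drop_poly 1 p * 'X.
Proof.
apply/polyP => -[|i]; first by rewrite coefD coefC coefMX addr0.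
by rewrite coefD coefC coefMX coef_drop_poly add0r addn1.
Qed.

Section KeyPolynomials.
Variables (K L : fieldType) (phi : {rmorphism K -> L}).
Variables (u : nat -> K) (g : nat -> L).
Hypothesis g_sqr : forall i, g i ^+ 2 = phi (u i).
Local Notation gm := (bigbit *%R g).
Hypothesis gm_free : forall N (c : nat -> K),
  \sum_(m < N) phi (c m) * gm m = 0 -> forall m, (m < N)%N -> c m = 0.
Variable b : nat -> nat.
Hypothesis b0_gt0 : (0 < b 0)%N.
Hypothesis b_double : forall i, ((b i).*2 < b i.+1)%N.

Local Notation B := {poly K}.
Local Notation S := {poly {poly K}}.
Local Notation w := (weight b).
Local Notation x := (polyC 'X : S).
Local Notation k c := (polyC (polyC c) : S).

Fixpoint keypoly (i : nat) : S :=
  if i is j.+1 then keypoly j ^+ 2 - k (u j) * x ^+ (b j).*2 else 'X.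

Definition keyprod (m : nat) : S := bigbit *%R keypoly m.

Lemma keypoly_size_monic i : size (keypoly i) = (2 ^ i).+1 /\ keypoly i \is monic.
Proof.
elim: i => [|i [sP mP]] /=; first by rewrite size_polyX monicX.
have sP2 : size (keypoly i ^+ 2) = (2 ^ i.+1).+1.
  by rewrite expr2 size_monicM ?monic_neq0 // sP expnS; lia.
have lt : (size (- (k (u i) * x ^+ (b i).*2))%R < size (keypoly i ^+ 2))%N.
  rewrite size_polyN -polyC_exp -polyCM sP2; apply: leq_ltn_trans (size_polyC_leq1 _) _.
  by rewrite ltnS expn_gt0.
by rewrite size_polyDl // sP2; split=> //; rewrite monicE lead_coefDl // -monicE rpredX.
Qed.

Lemma keyprod_addn m i : ~~ bit m i -> keyprod (m + 2 ^ i) = keypoly i * keyprod m.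
Proof. exact: (bigbit_addn *%R). Qed.

Lemma keyprod0 : keyprod 0 = 1. Proof. exact: bigbit0. Qed.

Lemma keyprod_size_monic m : size (keyprod m) = m.+1 /\ keyprod m \is monic.
Proof.
elim/bit_ind: m => [|m i mi [sQ mQ]]; first by rewrite keyprod0 size_poly1 monic1.
have [sP mP] := keypoly_size_monic i.
rewrite keyprod_addn // size_monicM ?monic_neq0 // sP sQ monicMr //; split=> //.
by rewrite addSn addnS addnC.
Qed.

(** Coordinates in the triangular basis [keyprod], found from the top down and packed as a
    polynomial whose j-th coefficient is the j-th coordinate. They describe f once [size f <= n];
    fixing n separately from f makes the map linear. *)
Fixpoint keycoef_rec (n : nat) (f : S) : S :=
  if n is j.+1 then f`_j *: 'X^j + keycoef_rec j (f - f`_j *: keyprod j) else 0.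

Definition keycoef (f : S) : S := keycoef_rec (size f) f.

Lemma keycoef_rec_linear n : linear (keycoef_rec n).
Proof.
elim: n => [|n IH] a f h /=; first by rewrite scaler0 addr0.
rewrite coefD coefZ scalerDr !scalerDl !scalerA.
rewrite [X in keycoef_rec n X](_ : _ = a *: (f - f`_n *: keyprod n) + (h - h`_n *: keyprod n)).
  by rewrite IH addrACA.
by rewrite scalerBr scalerA opprD addrACA.
Qed.

HB.instance Definition _ n := GRing.isLinear.Build B S S _ (keycoef_rec n) (@keycoef_rec_linear n).

Lemma keycoef_rec_widen n (f : S) : (size f <= n)%N -> keycoef f = keycoef_rec n f.
Proof.
move=> /subnK <-; rewrite /keycoef; elim: (n - size f)%N => //= j ->.
by rewrite nth_default ?leq_addl // !scale0r add0r subr0.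
Qed.

Fact keycoef_linear : linear keycoef.
Proof.
move=> a f h; set n := maxn (size (a *: f + h)) (maxn (size f) (size h)).
rewrite !(@keycoef_rec_widen n) ?linearP // /n !leq_max leqnn ?orbT //.
Qed.
HB.instance Definition _ := GRing.isLinear.Build B S S _ keycoef keycoef_linear.

Lemma keycoef_keyprod m : keycoef (keyprod m) = 'X^m.
Proof.
have [sQ mQ] := keyprod_size_monic m.
have Q1 : (keyprod m)`_m = 1 by rewrite -[RHS](eqP mQ) lead_coefE sQ.
by rewrite (@keycoef_rec_widen m.+1) ?sQ //= Q1 !scale1r subrr raddf0 addr0.
Qed.

Lemma size_keycoef_rec n f : (size (keycoef_rec n f) <= n)%N.
Proof.
elim: n f => [|n IH] f /=; first by rewrite size_poly0.
apply: leq_trans (size_polyD _ _) _; rewrite geq_max; apply/andP; split.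
  by apply: leq_trans (size_scale_leq _ _) _; rewrite size_polyXn.
exact: leqW.
Qed.

Lemma keycoef_rec_sum n (f : S) : (size f <= n)%N ->
  f = \sum_(m < n) (keycoef_rec n f)`_m *: keyprod m.
Proof.
elim: n f => [|n IH] f sf.
  by rewrite big_ord0; apply/eqP; rewrite -size_poly_leq0.
have [sQ mQ] := keyprod_size_monic n.
have Q1 : (keyprod n)`_n = 1 by rewrite -[RHS](eqP mQ) lead_coefE sQ.
set h := f - f`_n *: keyprod n.
have sh : (size h <= n)%N.
  apply/leq_sizeP => j; rewrite leq_eqVlt => /orP[/eqP <-|nj].
    by rewrite coefB coefZ Q1 mulr1 subrr.
  by rewrite coefB coefZ (nth_default _ (leq_trans sf nj)) [(keyprod n)`_j]nth_default ?sQ // mulr0 subr0.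
rewrite big_ord_recr /= -/h coefD coefZ coefXn eqxx mulr1.
rewrite [(keycoef_rec n h)`_n]nth_default ?size_keycoef_rec // addr0.
rewrite (eq_bigr (fun m : 'I_n => (keycoef_rec n h)`_m *: keyprod m)).
  by rewrite -IH // subrK.
by move=> m _; rewrite coefD coefZ coefXn ltn_eqF // mulr0 add0r.
Qed.

Lemma keycoef_sum (f : S) : f = \sum_(m < size f) (keycoef f)`_m *: keyprod m.
Proof. exact: keycoef_rec_sum. Qed.

(* [wcoef f m n] is the coefficient in f of the monomial x ^ (n - w m) * keyprod m,
   which has value n. *)
Definition wcoef (f : S) (m n : nat) : K :=
  if (w m <= n)%N then (keycoef f)`_m`_(n - w m) else 0.

(** The part of f of weighted degree n, evaluated at x = 1 and P_i = [g i]. The range m <= n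
    suffices because m <= w m. *)
Definition leadform (n : nat) (f : S) : L :=
  \sum_(m < n.+1) phi (wcoef f m n) * gm m.

Local Notation lam := leadform.

Lemma wcoefD m n : {morph (fun f => wcoef f m n) : f h / f + h}.
Proof. by move=> f h; rewrite /wcoef; case: ifP => _; rewrite ?addr0 // raddfD /= !coefD. Qed.

Lemma wcoefC c f m n : wcoef (k c * f) m n = c * wcoef f m n.
Proof.
rewrite /wcoef; case: ifP => _; rewrite ?mulr0 //.
by rewrite mul_polyC linearZ /= coefZ coefCM.
Qed.

Lemma wcoefX f m n : wcoef (x * f) m n = if n is j.+1 then wcoef f m j else 0.
Proof.
rewrite /wcoef mul_polyC linearZ /= coefZ coefXM subn_eq0.
case: n => [|n]; first by case: ifP => // ->.
have [wn|nw] := leqP (w m) n; first by rewrite leqW //= subSn.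
by case: ifP.
Qed.

Lemma wcoef_keyprod m' m n : wcoef (keyprod m') m n = ((m == m') && (w m' == n))%:R.
Proof.
rewrite /wcoef keycoef_keyprod coefXn; case: eqVneq => [->|_] /=; last by rewrite coef0 if_same.
rewrite coef1 subn_eq0 eqn_leq; case: (w m' <= n)%N => //.
Qed.

Lemma leadform_widen N n f : (n < N)%N -> lam n f = \sum_(m < N) phi (wcoef f m n) * gm m.
Proof.
move=> nN; rewrite -(big_mkord xpredT (fun m => phi (wcoef f m n) * gm m)).
rewrite (@big_cat_nat _ _ _ n.+1) //= big_mkord [X in _ + X]big1_seq ?addr0 //.
move=> m /andP[_]; rewrite mem_index_iota => /andP[nm _].
by rewrite /wcoef leqNgt (leq_trans nm) ?leq_weight //= raddf0 mul0r.
Qed.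

Lemma leadformD n : {morph lam n : f h / f + h}.
Proof.
move=> f h; rewrite /lam -big_split; apply: eq_bigr => m _ /=.
by rewrite wcoefD raddfD mulrDl.
Qed.

Lemma leadformC n c f : lam n (k c * f) = phi c * lam n f.
Proof.
rewrite /lam big_distrr; apply: eq_bigr => m _ /=.
by rewrite wcoefC rmorphM mulrA.
Qed.

Lemma leadform0 n : lam n 0 = 0.
Proof. by rewrite -[0 in LHS](mul0r 0) -polyC0 -polyC0 leadformC raddf0 mul0r. Qed.

Lemma leadformX n f : lam n.+1 (x * f) = lam n f.
Proof.
rewrite (@leadform_widen n.+2 n) //; apply: eq_bigr => m _.
by rewrite wcoefX.
Qed.

Lemma leadform0X f : lam 0 (x * f) = 0.
Proof. by rewrite /lam big_ord1 wcoefX raddf0 mul0r. Qed.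

Lemma leadform_keyprod m n : lam n (keyprod m) = if w m == n then gm m else 0.
Proof.
rewrite (@leadform_widen (maxn n m).+1) ?ltnS ?leq_maxl //.
have mN : (m < (maxn n m).+1)%N by rewrite ltnS leq_maxr.
rewrite (bigD1 (Ordinal mN)) //= wcoef_keyprod eqxx /= big1 ?addr0.
  by case: eqP => _; rewrite ?rmorph1 ?mul1r // raddf0 mul0r.
move=> i; rewrite -val_eqE /= => /negbTE im.
by rewrite wcoef_keyprod im raddf0 mul0r.
Qed.

(** Independence of the products of the [g i] turns the vanishing of one element of L into the
    vanishing of every coefficient in degree n: no cancellation can hide a term of low value. *)
Lemma leadform_eq0 n f : lam n f = 0 -> forall m, wcoef f m n = 0.
Proof.
move=> E m; have [mn|nm] := leqP m n; first exact: (@gm_free n.+1 (wcoef f ^~ n)).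
by rewrite /wcoef leqNgt (leq_trans nm) // leq_weight.
Qed.

Definition value_ge (n : nat) (f : S) : Prop := forall j, (j < n)%N -> lam j f = 0.
Local Notation V := value_ge.

Lemma value_geD n f h : V n f -> V n h -> V n (f + h).
Proof. by move=> Vf Vh j jn; rewrite leadformD Vf // Vh // addr0. Qed.

Lemma value_ge_kmul n c f : V n f -> V n (k c * f).
Proof. by move=> Vf j jn; rewrite leadformC Vf // mulr0. Qed.

Lemma value_ge_le m n f : (m <= n)%N -> V n f -> V m f.
Proof. by move=> mn Vf j jm; apply: Vf; apply: leq_trans mn. Qed.

Lemma value_geS n f : V n.+1 f <-> V n f /\ lam n f = 0.
Proof.
split=> [Vf|[Vf f0] j]; first by split; [exact: value_ge_le Vf | exact: Vf].
by rewrite ltnS leq_eqVlt => /orP[/eqP ->|] //; exact: Vf.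
Qed.

Lemma leadformXn a n f : lam (a + n) (x ^+ a * f) = lam n f.
Proof. by elim: a => [|a IH]; rewrite ?mul1r // exprS -mulrA leadformX. Qed.

Lemma value_geX a n f : V n f -> V (a + n) (x ^+ a * f).
Proof.
move=> Vf; elim: a => [|a IH] j; first by rewrite mul1r; apply: Vf.
rewrite exprS -mulrA; case: j => [|j] lt; first by rewrite leadform0X.
by rewrite leadformX; apply: IH.
Qed.

(** By [leadform_eq0], an f of value at least n has no term of value below n, so it is a sum of
    monomials that all have value at least n. *)
Lemma value_ge_ind n (H : S -> Prop) :
    H 0 -> (forall f h, H f -> H h -> H (f + h)) ->
    (forall c a m, (n <= a + w m)%N -> H (k c * (x ^+ a * keyprod m))) ->
  forall f, V n f -> H f.
Proof.
move=> H0 HD Hm f Vf; rewrite (keycoef_sum f).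
apply: (big_ind H) => // m _; rewrite -mul_polyC.
set c := (keycoef f)`_m; rewrite (_ : c%:P = \sum_(a < size c) k c`_a * x ^+ a).
  rewrite big_distrl; apply: (big_ind H) => // a _ /=; rewrite -mulrA.
  have [an|na] := leqP n (a + w m); first exact: Hm.
  have := leadform_eq0 (Vf _ na) m; rewrite /wcoef leq_addl addnK => ->.
  by rewrite !polyC0 mul0r.
rewrite {1}(_ : c = \sum_(a < size c) c`_a *: 'X^a); last by rewrite -poly_def coefK.
by rewrite rmorph_sum; apply: eq_bigr => a _ /=; rewrite -mul_polyC polyCM -polyC_exp.
Qed.

(** If digit i of m is free, the product is again a basis element. If not, with m' = m - 2 ^ i, it
    equals P_(i+1) Q_(m') + u_i x^(2 b_i) Q_(m'). By induction, for all i at once, the first term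
    has value at least b_(i+1) + w m' > 2 b_i + w m', so the second gives the form, and u_i = g_i^2
    makes it g_i times the form of Q_m. *)
Lemma keypoly_mul_keyprod m i :
  V (b i + w m) (keypoly i * keyprod m) /\
  lam (b i + w m) (keypoly i * keyprod m) = g i * gm m.
Proof.
elim/ltn_ind: m i => m IH i.
have VQ m' : V (w m') (keyprod m') by move=> j jw; rewrite leadform_keyprod gtn_eqF.
have [mi|mi] := boolP (bit m i); last first.
  have wE : w (m + 2 ^ i)%N = (b i + w m)%N by rewrite /weight bigbit_addn.
  rewrite -keyprod_addn // -wE; split=> //; rewrite leadform_keyprod eqxx.
  by rewrite bigbit_addn.
have [E nb lt] := bigbit_subn mi; set m' := (m - 2 ^ i)%N in E nb lt.
have wE : (b i + w m = (b i).*2 + w m')%N.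
  by rewrite E /weight bigbit_addn //= -addnn -addnA.
have -> : keypoly i * keyprod m = keypoly i.+1 * keyprod m' +
    k (u i) * (x ^+ (b i).*2 * keyprod m').
  by rewrite E keyprod_addn //=; ring.
have [V1 _] := IH _ lt i.+1.
have {}V1 : V (b i + w m).+1 (keypoly i.+1 * keyprod m').
  by apply: value_ge_le V1; rewrite wE -addSn leq_add2r.
split.
  apply: value_geD; first by apply: value_ge_le V1.
  by apply: value_ge_kmul; rewrite wE; apply: value_geX.
rewrite leadformD V1 // add0r leadformC wE leadformXn leadform_keyprod eqxx.
by rewrite -g_sqr E bigbit_addn // expr2 -mulrA.
Qed.

(* This property is stable under sums and products in f, so it only has to be checked on
   x, on constants and on the key polynomials. *)
Let mul_good n (f : S) := forall n' h, V n' h ->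
  V (n + n') (f * h) /\ lam (n + n') (f * h) = lam n f * lam n' h.

Let V0 f : V 0 f. Proof. by []. Qed.

Let leadform1 : lam 0 1 = 1.
Proof.
by have := leadform_keyprod 0 0; rewrite keyprod0 weight0 eqxx => ->; exact: bigbit0.
Qed.

Let mul_good_V n f : mul_good n f -> V n f.
Proof. by move=> /(_ 0%N 1 (V0 1))[]; rewrite addn0 mulr1. Qed.

Let mul_goodD n f h : mul_good n f -> mul_good n h -> mul_good n (f + h).
Proof.
move=> gf gh n' r Vu; have [V1 E1] := gf _ _ Vu; have [V2 E2] := gh _ _ Vu.
by rewrite mulrDl; split; [exact: value_geD | rewrite !leadformD E1 E2 mulrDl].
Qed.

Let mul_good0 n : mul_good n 0.
Proof. by move=> n' h _; rewrite mul0r; split=> [j _|]; rewrite !leadform0 // mul0r. Qed.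

Let mul_goodM n f n' h : mul_good n f -> mul_good n' h -> mul_good (n + n') (f * h).
Proof.
move=> gf gh p r Vu; rewrite -mulrA -addnA.
have [V1 E1] := gh _ _ Vu; have [V2 E2] := gf _ _ V1.
have [_ ->] := gf _ _ (mul_good_V gh).
by split=> //; rewrite E2 E1 mulrA.
Qed.

Let mul_good_leq m n f : (m <= n)%N -> mul_good n f -> mul_good m f.
Proof.
move=> /subnK <-; elim: (n - m)%N => [//|j IH] gf; apply: IH => n' h Vh.
have [] := gf _ _ Vh; rewrite !addSn => /value_geS[V1 E1] _; split=> //.
by rewrite E1 (mul_good_V gf) ?mul0r.
Qed.

Let mul_good_k c : mul_good 0 (k c).
Proof.
move=> n h Vh; split; first exact: value_ge_kmul.
by rewrite -[k c in RHS]mulr1 !leadformC leadform1 mulr1.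
Qed.

Let mul_good_x : mul_good 1 x.
Proof.
move=> n h Vh; split; first by have := @value_geX 1 _ _ Vh; rewrite expr1.
by rewrite -[x in RHS]mulr1 !leadformX leadform1 mul1r.
Qed.

(** By [value_ge_ind] the other factor may be a monomial, which is the case of [keypoly_mul_keyprod]
    up to a power of x. If the monomial has value above n', both forms vanish. *)
Let mul_good_keypoly i : mul_good (b i) (keypoly i).
Proof.
have -> : mul_good (b i) (keypoly i) = forall n' h, V n' h ->
    V (b i + n') (keypoly i * h) /\ lam (b i + n') (keypoly i * h) = g i * lam n' h.
  have PQ : keypoly i = keyprod (2 ^ i) by rewrite /keyprod bigbit_pow2.
  have : lam (b i) (keypoly i) = g i.
    by rewrite PQ leadform_keyprod /weight bigbit_pow2 eqxx bigbit_pow2.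
  by rewrite /mul_good => ->.
move=> n'; apply: value_ge_ind.
- by rewrite mulr0; split=> [j _|]; rewrite !leadform0 // mulr0.
- move=> f h [V1 E1] [V2 E2]; rewrite mulrDr.
  by split; [exact: value_geD | rewrite !leadformD E1 E2 mulrDr].
move=> c a m le.
have [VP EP] := keypoly_mul_keyprod m i.
rewrite (_ : keypoly i * _ = k c * (x ^+ a * (keypoly i * keyprod m))); last by ring.
have {}VP := @value_geX a _ _ VP.
have {}EP := etrans (leadformXn a (b i + w m) (keypoly i * keyprod m)) EP.
have VQ : V (a + w m) (x ^+ a * keyprod m).
  by apply: value_geX => j jw; rewrite leadform_keyprod gtn_eqF.
split; first by apply: value_ge_kmul; apply: value_ge_le VP; lia.
rewrite !leadformC; move: le; rewrite leq_eqVlt => /orP[/eqP ->|lt]; last first.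
  by rewrite VP ?VQ ?mulr0 //; lia.
by rewrite addnCA EP leadformXn leadform_keyprod eqxx mulrCA.
Qed.

Let mul_good_keyprod m : mul_good (w m) (keyprod m).
Proof.
elim/bit_ind: m => [|m i mi gQ].
  by rewrite keyprod0 weight0 -polyC1 -polyC1; exact: mul_good_k.
by rewrite keyprod_addn // /weight bigbit_addn //; apply: mul_goodM.
Qed.

Let mul_good_of_value_ge n f : V n f -> mul_good n f.
Proof.
apply: value_ge_ind => [|*|c a m le]; [exact: mul_good0|exact: mul_goodD|].
apply: mul_good_leq le _; rewrite -[(a + w m)%N]add0n; apply: mul_goodM => //.
apply: mul_goodM => //; elim: a => [|a IH]; first by rewrite expr0 -polyC1 -polyC1; exact: mul_good_k.
by rewrite exprS -add1n; exact: mul_goodM.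
Qed.

Lemma value_geM n n' f h : V n f -> V n' h -> V (n + n') (f * h).
Proof. by move=> Vf Vh; case: (mul_good_of_value_ge Vf Vh). Qed.

Lemma leadformM n n' f h : V n f -> V n' h -> lam (n + n') (f * h) = lam n f * lam n' h.
Proof. by move=> Vf Vh; case: (mul_good_of_value_ge Vf Vh). Qed.

Lemma value_geMr n f h : V n h -> V n (f * h).
Proof. by rewrite -[X in V X (_ * _)]add0n; apply: value_geM. Qed.

(** Split f into its constant term, a multiple of x and a multiple of y = [keypoly 0]. The last has
    value at least b 0 > 0, so only the constant survives in degree 0. *)
Lemma leadform_const (f : S) : lam 0 f = phi f`_0`_0.
Proof.
rewrite {1}(_ : f = k f`_0`_0 * 1 + x * (drop_poly 1 f`_0)%:P + drop_poly 1 f * keypoly 0); last first.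
  by rewrite mulr1 -polyCM -polyCD mulrC -!poly_split.
rewrite !leadformD leadformC leadform1 leadform0X addr0 mulr1.
have VP : V 1 (keypoly 0) by apply: value_ge_le (mul_good_V (mul_good_keypoly 0)).
by rewrite (value_geMr _ VP) // addr0.
Qed.

(** Any monomial occurring in f will do, since by [leadform_eq0] the form in its degree is nonzero.
    The one chosen is the top term of the top coordinate. *)
Lemma leadform_neq0 (f : S) : f != 0 -> exists n, lam n f != 0.
Proof.
move=> f0; have c0 : keycoef f != 0.
  apply: contra_neq f0 => c0; rewrite (keycoef_sum f) big1 // => m _.
  by rewrite c0 coef0 scale0r.
pose m := (size (keycoef f)).-1; pose a := (size (keycoef f)`_m).-1.
have /eqP ca : (keycoef f)`_m`_a != 0 by rewrite -!lead_coefE !lead_coef_eq0.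
exists (a + w m)%N; apply/eqP => /leadform_eq0 /(_ m).
by rewrite /wcoef leq_addl addnK.
Qed.

End KeyPolynomials.

(** * Noetherian rings *)

Section Ideals.
Variable A : comNzRingType.

Lemma submoduleP (V : lmodType A) (N : set V) :
  submodule N <-> N 0 /\ forall a u v, N u -> N v -> N (a *: u + v).
Proof.
rewrite /submodule; split=> [[N0 NL]|[N0 NL]].
  by split=> [|a u v Nu Nv]; apply: set_mem; [|apply: NL; exact: mem_set].
split; first exact: mem_set.
by move=> a u v /set_mem Nu /set_mem Nv; apply: mem_set; exact: NL.
Qed.

Lemma idealP (I : set A) :
  ideal I <-> I 0 /\ forall a u v, I u -> I v -> I (a * u + v).
Proof. exact: submoduleP. Qed.

Lemma idealM (I : set A) a u : ideal I -> I u -> I (a * u).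
Proof. by move=> /idealP[I0 IL] Iu; rewrite -[_ * _]addr0; apply: IL. Qed.

Lemma idealr_closedP (I : set A) :
  idealr_closed [in I] <->
  [/\ I 0, ~ I 1 & forall a u v, I u -> I v -> I (a * u + v)].
Proof.
rewrite /idealr_closed; split=> [[N0 N1 NL]|[N0 N1 NL]]; split.
- exact: set_mem.
- by move=> /mem_set I1; move/negP: N1; exact.
- by move=> a u v Nu Nv; apply: set_mem; apply: NL; exact: mem_set.
- exact: mem_set.
- by apply/negP => /set_mem.
by move=> a u v /set_mem Nu /set_mem Nv; apply: mem_set; exact: NL.
Qed.

Lemma prime_idealr_closedP (I : set A) :
  prime_idealr_closed [in I] <-> forall u v, I (u * v) -> I u \/ I v.
Proof.
split=> [P u v /mem_set /P /orP[] /set_mem|P u v /set_mem /P [] /mem_set H]; [by left|by right| |].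
  by apply/orP; left.
by apply/orP; right.
Qed.

Lemma ideal_sum (I : set A) n (c f : nat -> A) : ideal I ->
  (forall i, (i < n)%N -> I (f i)) -> I (\sum_(i < n) c i * f i).
Proof.
move=> /idealP[I0 IL]; elim: n => [|n IH] If; first by rewrite big_ord0.
by rewrite big_ord_recr /= addrC; apply: IL; [exact: If | apply: IH => i /ltnW; exact: If].
Qed.

Lemma ideal_genP (s : seq A) x :
  ideal_gen s x <-> exists c : nat -> A, x = \sum_(i < size s) c i * s`_i.
Proof.
split=> [[c ->]|[c ->]]; last by exists (fun i => c i).
exists (fun i => if insub i is Some j then c j else 0).
by apply: eq_bigr => i _; rewrite valK.
Qed.

Lemma ideal_gen_mkseq (f : nat -> A) n x :
  ideal_gen (mkseq f n) x <-> exists c : nat -> A, x = \sum_(i < n) c i * f i.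
Proof.
rewrite ideal_genP size_mkseq; split=> -[c ->]; exists c; apply: eq_bigr => i _; by rewrite nth_mkseq.
Qed.

Lemma ideal_gen_ideal (s : seq A) : ideal (ideal_gen s).
Proof.
apply/idealP; split=> [|a u v].
  by exists (fun=> 0); rewrite big1 // => i _; rewrite mul0r.
move=> [c ->] [d ->]; exists (fun i => a * c i + d i).
by rewrite big_distrr -big_split; apply: eq_bigr => i _ /=; ring.
Qed.

Lemma mem_ideal_gen (s : seq A) x : x \in s -> ideal_gen s x.
Proof.
move=> xs; apply/ideal_genP; exists (fun i => (i == index x s)%:R).
have lt : (index x s < size s)%N by rewrite index_mem.
rewrite (bigD1 (Ordinal lt)) //= eqxx mul1r nth_index // big1 ?addr0 // => i.
by rewrite -val_eqE /= => /negbTE ->; rewrite mul0r.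
Qed.

Lemma ideal_gen_sub (I : set A) (s : seq A) : ideal I ->
  (forall x, x \in s -> I x) -> ideal_gen s `<=` I.
Proof.
move=> hI Is x /ideal_genP[c ->]; apply: (@ideal_sum I _ c (nth 0 s)) => // i lt.
by apply: Is; exact: mem_nth.
Qed.

End Ideals.

Lemma noetherian_field (k : fieldType) : noetherian_ring k.
Proof.
move=> I hI; have /idealP[I0 IL] := hI.
have [[x [Ix x0]]|N] := pselect (exists x, I x /\ x != 0).
  exists [:: x]; apply/seteqP; split=> [y Iy|].
    by exists (fun=> y / x); rewrite big_ord1 /= mulfVK.
  by apply: (ideal_gen_sub hI) => y; rewrite inE => /eqP ->.
exists [::]; apply/seteqP; split=> [y Iy|]; last exact: (ideal_gen_sub hI).
have -> : y = 0 by apply/eqP/negPn/negP => y0; apply: N; exists y.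
by case/idealP: (@ideal_gen_ideal k [::]).
Qed.

(* Pick successively [f n] of least degree in I outside (f 0, ..., f (n - 1)); since the
   ideal of all leading coefficients is finitely generated, some [f N] can be reduced to
   a smaller degree, which contradicts its choice. *)
Theorem hilbert_basis (A : comNzRingType) :
  noetherian_ring A -> noetherian_ring {poly A}.
Proof.
move=> noeA I hI; have /idealP[I0 IL] := hI.
apply/not_existsP => NG.
pose P (s : seq {poly A}) y := (forall z, z \in s -> I z) ->
  [/\ I y, ~ ideal_gen s y & forall h, I h -> ~ ideal_gen s h -> (size y <= size h)%N].
have [step stepP] : {step & forall s, P s (step s)}.
  apply: (@choice _ _ P) => s.
  have [Is|] := pselect (forall z, z \in s -> I z); last by exists 0.
  have exn : exists n, `[< exists h, [/\ I h, ~ ideal_gen s h & size h = n] >].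
    have [[h [Ih nh]]|H] := pselect (exists h, I h /\ ~ ideal_gen s h).
      by exists (size h); apply/asboolP; exists h.
    exfalso; apply: (NG s); apply/seteqP; split; last exact: (ideal_gen_sub hI).
    by move=> h Ih; apply: contrapT => nh; apply: H; exists h.
  case: (ex_minnP exn) => n /asboolP[y [Iy ny <-]] min; exists y => _; split=> // h Ih nh.
  by apply: min; apply/asboolP; exists h.
pose F n := iter n (fun s => rcons s (step s)) [::].
pose f n := step (F n).
have FE n : F n = mkseq f n.
  elim: n => // n IH; rewrite /F iterS -/(F n) -/(f n) {}IH.
  by rewrite /mkseq -addn1 iotaD map_cat add0n cats1.
have If n : I (f n).
  suff H : forall z, z \in F n -> I z by case: (stepP _ H).
  elim: n => // n IH z; rewrite /F iterS -/(F n) mem_rcons inE => /orP[/eqP ->|]; last exact: IH.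
  by case: (stepP _ IH).
have IF n z : z \in F n -> I z.
  by rewrite FE => /mapP[i _ ->]; exact: If.
have fN n := stepP _ (IF n).
pose lc n := mkseq (fun i => lead_coef (f i)) n.
pose J : set A := [set c | exists n, ideal_gen (lc n) c].
have lc_mono m n : (m <= n)%N -> ideal_gen (lc m) `<=` ideal_gen (lc n).
  move=> mn; apply: (ideal_gen_sub (@ideal_gen_ideal _ _)).
  move=> z /mapP[i]; rewrite mem_iota add0n => /andP[_ im] ->.
  by apply: mem_ideal_gen; apply: map_f; rewrite mem_iota add0n (leq_trans im).
have hJ : ideal J.
  apply/idealP; split.
    by exists 0%N; case/idealP: (ideal_gen_ideal (lc 0)).
  move=> a u v [m gu] [n gv]; exists (maxn m n).
  have /idealP[_ L] := ideal_gen_ideal (lc (maxn m n)).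
  by apply: L; [exact: (lc_mono _ _ (leq_maxl m n)) | exact: (lc_mono _ _ (leq_maxr m n))].
have [t tJ] := noeA J hJ.
have [N tN] : exists N, forall z, z \in t -> ideal_gen (lc N) z.
  have : forall z, z \in t -> J z by rewrite tJ => z; exact: mem_ideal_gen.
  elim: {tJ} t => [|z t IH] Jt; first by exists 0%N.
  have [N1 H1] := IH (fun y yt => Jt y (@mem_behead _ (z :: t) _ yt)).
  have [N2 H2] := Jt z (mem_head _ _).
  exists (maxn N1 N2) => y; rewrite inE => /orP[/eqP ->|/H1 H].
    by exact: (lc_mono _ _ (leq_maxr N1 N2)).
  by exact: (lc_mono _ _ (leq_maxl N1 N2)).
have : ideal_gen (lc N) (lead_coef (f N)).
  have : J (lead_coef (f N)).
    exists N.+1; apply: mem_ideal_gen; apply/mapP; exists N => //.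
    by rewrite mem_iota add0n ltnSn.
  by rewrite tJ; apply: (ideal_gen_sub (@ideal_gen_ideal _ _) tN).
move=> /ideal_gen_mkseq[c cE].
have [_ nN minN] := fN N.
(* [f N] also lies outside the smaller ideal generated by [F i], so it competed in the choice of
   [f i]. *)
have szf i : (i < N)%N -> (size (f i) <= size (f N))%N.
  move=> iN; have [_ _] := fN i; apply; first exact: If.
  move=> H; apply: nN; move: H; apply: (ideal_gen_sub (@ideal_gen_ideal _ _)).
  move=> z; rewrite FE => /mapP[j]; rewrite mem_iota add0n => /andP[_ ji] ->.
  apply: mem_ideal_gen; rewrite FE; apply: map_f; rewrite mem_iota add0n.
  exact: ltn_trans iN.
pose r := \sum_(i < N) (c i *: 'X^(size (f N) - size (f i))) * f i.
have gr : ideal_gen (F N) r.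
  rewrite FE; apply/ideal_gen_mkseq.
  by exists (fun i => c i *: 'X^(size (f N) - size (f i))).
pose h := f N - r.
have nh : ~ ideal_gen (F N) h.
  move=> gh; apply: nN; rewrite -/(f N) -[f N](subrK r) -[f N - r]mul1r.
  by have /idealP[_ L] := ideal_gen_ideal (F N); exact: L.
have Ih : I h.
  rewrite /h addrC -mulN1r; apply: IL => //.
  by apply: (ideal_gen_sub hI (IF N)).
have fN0 : (0 < size (f N))%N.
  rewrite size_poly_gt0; apply/eqP => E; apply: nN; rewrite -/(f N) E.
  by case/idealP: (ideal_gen_ideal (F N)).
have := minN h Ih nh; rewrite -/(f N) leqNgt => /negP; apply.
rewrite -[X in (_ < X)%N](prednK fN0) ltnS; apply/leq_sizeP => j.
rewrite /h /r coefB coef_sum leq_eqVlt => /orP[/eqP <-|lt].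
  rewrite -lead_coefE cE; apply/eqP; rewrite subr_eq0; apply/eqP; apply: eq_bigr => i _.
  (* As [size (f i) <= size (f N)], the top index can lie below the shift only if [f i] is zero, and
     then its leading coefficient is 0 as well. *)
  rewrite -scalerAl coefZ coefXnM; case: ifP => [lt|_]; last first.
    have [f0|f0] := posnP (size (f i)).
      by rewrite !nth_default ?f0 // lead_coefE nth_default ?f0.
    rewrite lead_coefE; congr (_ * _`__).
    by have := szf _ (ltn_ord i); lia.
  have f0 : size (f i) = 0%N by move: lt; have := szf _ (ltn_ord i); lia.
  by rewrite lead_coefE nth_default ?f0.
have jN : (size (f N) <= j)%N by rewrite -(prednK fN0).
rewrite (nth_default _ jN) sub0r.
rewrite big1 ?oppr0 // => i _; rewrite -scalerAl coefZ coefXnM; case: ifP => _; rewrite ?mulr0 //.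
by rewrite nth_default ?mulr0 // leq_subRL ?subnK ?szf // (leq_trans (leq_subr _ _)).
Qed.

(** * Localization *)

(* The localization of a domain S at the kernel of a ring morphism from S to a field. *)
Section Localization.
Variables (S : idomainType) (k : fieldType) (eps : {rmorphism S -> k}).

(** Taking the localization as a subring of the fraction field lets it inherit the ring laws; a
    fraction belongs to it when some denominator lies outside the kernel of [eps]. *)
Definition in_loc : {pred {fraction S}} := fun z =>
  `[< exists f g, eps g != 0 /\ z * tofrac g = tofrac f >].

Fact in_loc_subring_closed : subring_closed in_loc.
Proof.
split=> [|y z /asboolP[f [g [g0 E]]] /asboolP[f' [g' [g0' E']]]|
          y z /asboolP[f [g [g0 E]]] /asboolP[f' [g' [g0' E']]]]; apply/asboolP.
- by exists 1, 1; rewrite rmorph1 oner_neq0 mul1r.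
- exists (f * g' - f' * g), (g * g'); rewrite rmorphM mulf_neq0 //; split=> //.
  by rewrite rmorphB !rmorphM /= -E -E'; ring.
exists (f * f'), (g * g'); rewrite rmorphM mulf_neq0 //; split=> //.
by rewrite !rmorphM /= -E -E'; ring.
Qed.
HB.instance Definition _ :=
  GRing.isSubringClosed.Build {fraction S} in_loc in_loc_subring_closed.

Record loc : Type := Loc { loc_val : {fraction S}; _ : loc_val \in in_loc }.
HB.instance Definition _ := [isSub for loc_val].
HB.instance Definition _ := [Choice of loc by <:].
HB.instance Definition _ := [SubChoice_isSubComNzRing of loc by <:].

Definition loc_unit : {pred loc} := fun a => `[< exists b, b * a = 1 >].

Definition loc_inv (a : loc) : loc :=
  if pselect (exists b, b * a = 1) is left h then projT1 (cid h) else a.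

Fact loc_mulVr : {in loc_unit, left_inverse 1 loc_inv *%R}.
Proof.
move=> a /asboolP h; rewrite /loc_inv; case: pselect => // h'.
by case: cid.
Qed.
Fact loc_unitPl a b : b * a = 1 -> loc_unit a.
Proof. by move=> E; apply/asboolP; exists b. Qed.
Fact loc_inv_out : {in [predC loc_unit], loc_inv =1 id}.
Proof.
by move=> a; rewrite inE /= => /asboolP h; rewrite /loc_inv; case: pselect.
Qed.
HB.instance Definition _ :=
  GRing.ComNzRing_hasMulInverse.Build loc loc_mulVr loc_unitPl loc_inv_out.

Fact loc_integral : GRing.integral_domain_axiom loc.
Proof.
move=> a b /(congr1 val); rewrite rmorphM rmorph0 /= => /eqP; rewrite mulf_eq0.
by rewrite -!(rmorph0 (val : loc -> _)) !(inj_eq val_inj).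
Qed.
HB.instance Definition _ := GRing.ComUnitRing_isIntegral.Build loc loc_integral.

Fact to_loc_subproof f : tofrac f \in in_loc.
Proof. by apply/asboolP; exists f, 1; rewrite !rmorph1 oner_neq0 mulr1. Qed.

Definition to_loc (f : S) : loc := Loc (to_loc_subproof f).

Fact to_loc_zmod_morphism : zmod_morphism to_loc.
Proof. by move=> f g; apply: val_inj; rewrite /= rmorphB. Qed.
HB.instance Definition _ := GRing.isZmodMorphism.Build S loc to_loc to_loc_zmod_morphism.
Fact to_loc_monoid_morphism : monoid_morphism to_loc.
Proof.
by split=> [|f g]; apply: val_inj; rewrite /= ?rmorph1 ?rmorphM.
Qed.
HB.instance Definition _ := GRing.isMonoidMorphism.Build S loc to_loc to_loc_monoid_morphism.

Local Notation io := to_loc.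

Lemma to_loc_inj : injective io.
Proof. by move=> f g /(congr1 val) /= /eqP; rewrite tofrac_eq => /eqP. Qed.

Lemma locP (a : loc) : exists f g, eps g != 0 /\ a * io g = io f.
Proof.
by case: a => z zl; have /asboolP[f [g [g0 E]]] := zl; exists f, g; split=> //; exact: val_inj.
Qed.

Lemma to_loc_unit g : eps g != 0 -> exists b : loc, b * io g = 1.
Proof.
move=> g0; have zl : (tofrac g)^-1 \in in_loc.
  apply/asboolP; exists 1, g; split=> //; rewrite rmorph1 mulVf // tofrac_eq0.
  by apply: contra_neq g0 => ->; rewrite rmorph0.
exists (Loc zl); apply: val_inj; rewrite /= mulVf // tofrac_eq0.
by apply: contra_neq g0 => ->; rewrite rmorph0.
Qed.

Lemma to_loc_eq0 f : (io f == 0) = (f == 0).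
Proof. by rewrite -(rmorph0 to_loc) (inj_eq to_loc_inj). Qed.

(** Denominators are units here, so membership in an ideal is decided by any numerator. This reduces
    ideals of the localization to their contractions to S. *)
Lemma ideal_locE (I : set loc) (a : loc) f g : ideal I -> eps g != 0 -> a * io g = io f ->
  I a <-> I (io f).
Proof.
move=> /idealP[I0 IL] g0 E; have IM c u : I u -> I (c * u).
  by move=> Iu; rewrite -[_ * _]addr0; apply: IL.
split=> [Ia|If]; first by rewrite -E mulrC; apply: IM.
have [b bE] := to_loc_unit g0.
by rewrite -[a]mulr1 -bE mulrCA E; apply: IM.
Qed.

Lemma noetherian_loc : noetherian_ring S -> noetherian_ring loc.
Proof.
move=> noeS I hI; have /idealP[I0 IL] := hI.
have [|s sE] := noeS (io @^-1` I).
  by apply/idealP; rewrite /preimage /= rmorph0; split=> // a u v Iu Iv; rewrite rmorphD rmorphM; apply: IL.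
exists (map io s); apply/seteqP; split=> [a Ia|]; last first.
  apply: (ideal_gen_sub hI) => _ /mapP[f fs ->].
  suff : (io @^-1` I) f by [].
  by rewrite sE; exact: mem_ideal_gen.
have [f [g [g0 E]]] := locP a.
apply/(ideal_locE (@ideal_gen_ideal _ _) g0 E).
have : (io @^-1` I) f by apply/(ideal_locE hI g0 E).
rewrite sE => /ideal_genP[c ->]; rewrite rmorph_sum.
apply/ideal_genP; exists (io \o c); rewrite size_map; apply: eq_bigr => i _.
by rewrite rmorphM (nth_map 0).
Qed.

Section Kernel.
Variables (D : idomainType) (psi : {rmorphism S -> D}).
Hypothesis psi_eps : forall g, psi g = 0 -> eps g = 0.

(** The extension of the prime ker psi, which stays proper because [psi_eps] places it inside the
    kernel of [eps]. Three choices of psi give the chain 0, (y), (x, y) in the plane. *)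
Definition loc_ker : set loc := [set a | exists f g, [/\ eps g != 0, a * io g = io f & psi f = 0]].

Lemma loc_kerE a f g : eps g != 0 -> a * io g = io f -> loc_ker a <-> psi f = 0.
Proof.
move=> g0 E; split=> [[f' [g' [g0' E' f'0]]]|f0]; last by exists f, g.
have /to_loc_inj/(congr1 psi)/eqP : io (f * g') = io (f' * g).
  by rewrite !rmorphM /= -E -E'; ring.
rewrite !rmorphM f'0 mul0r mulf_eq0 => /orP[/eqP //|/eqP/psi_eps /eqP].
by rewrite (negbTE g0').
Qed.

Lemma loc_ker_to f : loc_ker (io f) <-> psi f = 0.
Proof. by apply: (@loc_kerE _ _ 1); rewrite ?rmorph1 ?oner_neq0 ?mulr1. Qed.

Lemma loc_ker_prime : prime_ideal loc_ker.
Proof.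
split.
  apply/idealr_closedP; split.
  - by rewrite -(rmorph0 to_loc); apply/loc_ker_to; rewrite rmorph0.
  - by rewrite -(rmorph1 to_loc) => /loc_ker_to; rewrite rmorph1 => /eqP; rewrite oner_eq0.
  move=> a u v [f [g [g0 E f0]]] [f' [g' [g0' E' f0']]].
  have [p [q [q0 Ea]]] := locP a.
  exists (p * f * g' + f' * (q * g)), (q * g * g'); split.
  - by rewrite !rmorphM !mulf_neq0.
  - by rewrite rmorphD !rmorphM /= -Ea -E -E'; ring.
  by rewrite rmorphD !rmorphM f0 f0' mulr0 !mul0r addr0.
apply/prime_idealr_closedP => u v.
have [f [g [g0 E]]] := locP u; have [f' [g' [g0' E']]] := locP v.
have gg : eps (g * g') != 0 by rewrite rmorphM mulf_neq0.
have EE : u * v * io (g * g') = io (f * f') by rewrite !rmorphM /= -E -E'; ring.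
move=> /(loc_kerE gg EE)/eqP; rewrite rmorphM mulf_eq0 => /orP[] /eqP H.
  by left; apply/(loc_kerE g0 E).
by right; apply/(loc_kerE g0' E').
Qed.

End Kernel.

Definition loc_max : set loc := loc_ker eps.

Lemma loc_maxE a f g : eps g != 0 -> a * io g = io f -> loc_max a <-> eps f = 0.
Proof. exact: loc_kerE. Qed.

Lemma proper_sub_loc_max (I : set loc) : idealr_closed [in I] -> I `<=` loc_max.
Proof.
move=> /idealr_closedP[I0 I1 IL] a Ia; have [f [g [g0 E]]] := locP a.
apply/(loc_maxE g0 E)/eqP/negPn/negP => f0; apply: I1.
have [b bE] := to_loc_unit f0.
have -> : 1 = (b * io g) * a + 0 by rewrite addr0 -bE -E; ring.
exact: IL.
Qed.

Lemma local_ring_loc : local_ring loc_max.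
Proof.
have [mi _] := loc_ker_prime (fun g (h : eps g = 0) => h).
split; first split=> //.
  move=> I hI mI; apply/seteqP; split=> //; exact: proper_sub_loc_max.
move=> m' [hm' mm']; apply/esym; apply: mm' => //; exact: proper_sub_loc_max.
Qed.

End Localization.
Arguments to_loc {S k} eps f.
Arguments loc_ker {S k} eps {D} psi.
Arguments loc_max {S k} eps.

(** * Chains of primes in k[x, y] *)

Section HeightTwo.
Variable k : fieldType.
Local Notation S := {poly {poly k}}.

(* If p1 contains no nonzero constant, the gcd of an element of p1 of least degree with
   an element of p2 outside p1 is a nonzero constant of p2, up to constant factors. *)
Lemma prime_chain_coef (p1 p2 : set S) :
    (forall u v, p1 (u * v) -> p1 u \/ p1 v) -> ideal p1 -> ideal p2 ->
    p1 `<=` p2 -> (exists f, p1 f /\ f != 0) -> (exists h, p2 h /\ ~ p1 h) ->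
  exists c : {poly k}, c != 0 /\ p2 c%:P.
Proof.
move=> pr hp1 hp2 p12 [f0 [pf0 f00]] [h [ph nh]].
have M1 a u := @idealM _ _ a u hp1; have /idealP[_ L2] := hp2; have M2 a u := @idealM _ _ a u hp2.
have [[c [c0 pc]]|N1] := pselect (exists c : {poly k}, c != 0 /\ p1 c%:P).
  by exists c; split=> //; apply: p12.
have exn : exists n, `[< exists f, [/\ p1 f, f != 0 & size f = n] >].
  by exists (size f0); apply/asboolP; exists f0.
case: (ex_minnP exn) => n /asboolP[f [pf fn0 fn]] min.
set d := gcdp f h.
have /Pdiv.Idomain.dvdpP[[c e] /= c0 cE] : d %| f by exact: dvdp_gcdl.
have /Pdiv.Idomain.dvdpP[[c' e'] /= c'0 c'E] : d %| h by exact: dvdp_gcdr.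
have d0 : d != 0 by rewrite gcdp_eq0 (negbTE fn0).
(* A nonzero constant multiple of h is a multiple of d, so d in p1 would put that constant or h in
   p1. Hence in c f = e d the cofactor e lies in p1, and minimality of f leaves no degree for d. *)
have nd : ~ p1 d.
  move=> /(M1 e'); rewrite -c'E -mul_polyC => /pr[pc|//].
  by apply: N1; exists c'.
have /pr[pe|//] : p1 (e * d) by rewrite -cE -mul_polyC; exact: M1.
have e0 : e != 0.
  by apply/eqP => E; move/eqP: cE; rewrite E mul0r -mul_polyC mulf_eq0 polyC_eq0 (negbTE c0) (negbTE fn0).
have sfe : (size f <= size e)%N by rewrite fn; apply: min; apply/asboolP; exists e.
have sd : size d = 1%N.
  have := congr1 (fun p : S => size p) cE; rewrite size_scale // size_mul // => sE.
  move: sE sfe; rewrite -size_poly_gt0 in d0; move: d0.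
  by case: (size d) => // -[|j] _ //; rewrite addnS /= => ->; rewrite addnS ltnNge leq_addr.
have /size_poly1P[d1 d10 dE] : size d == 1%N by rewrite sd.
have [[u v] /= ] := Pdiv.Idomain.Bezoutp f h.
move/Pdiv.Idomain.eqpP=> [[c1 c2] /= /andP[c10 c20] E].
exists (c2 * d1); split; first by rewrite mulf_neq0.
rewrite polyCM -dE mul_polyC -/d -E -mul_polyC; apply: (M2); apply: (L2) => //.
  exact: p12.
exact: M2.
Qed.

End HeightTwo.

(** * The local ring of the plane at the origin *)

Section LocalPlane.
Variable k : fieldType.
Local Notation S := {poly {poly k}}.

Definition const_coef (f : S) : k := f`_0`_0.

Fact const_coef_zmod_morphism : zmod_morphism const_coef.
Proof. by move=> f g; rewrite /const_coef !coefB. Qed.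
HB.instance Definition _ := GRing.isZmodMorphism.Build S k const_coef const_coef_zmod_morphism.
Fact const_coef_monoid_morphism : monoid_morphism const_coef.
Proof.
by split=> [|f g]; rewrite /const_coef ?coef1 // !coef0M.
Qed.
HB.instance Definition _ := GRing.isMonoidMorphism.Build S k const_coef const_coef_monoid_morphism.

Local Notation A := (loc const_coef).
Definition plane_max : set A := loc_max const_coef.

Local Notation io := (to_loc const_coef).

Lemma noetherian_local_plane : noetherian_ring A.
Proof.
apply: noetherian_loc; do 2 apply: hilbert_basis; exact: noetherian_field.
Qed.

Lemma plane_max_gen : plane_max = ideal_gen [:: io ('X%:P); io 'X].
Proof.
apply/seteqP; split=> [a ma|a]; last first.
  apply: ideal_gen_sub.
    have [/idealr_closedP[m0 _ mL] _] := loc_ker_prime (fun g (h : const_coef g = 0) => h).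
    exact/idealP.
  move=> _ /[!inE] /orP[] /eqP ->; apply/loc_ker_to => //=; rewrite /const_coef ?coefC /= ?coefX //=.
  by rewrite coef0.
have [f [g [g0 E]]] := locP a.
apply/(ideal_locE (@ideal_gen_ideal _ _) g0 E).
have f0 : const_coef f = 0 by apply/(loc_maxE g0 E).
rewrite (poly_split f) [f`_0]poly_split [f`_0`_0]f0 add0r.
apply/ideal_genP; exists (fun i => if i is 0 then io (drop_poly 1 f`_0)%:P else io (drop_poly 1 f)).
by rewrite !big_ord_recl big_ord0 addr0 /= -!rmorphM -rmorphD.
Qed.

(** Here [phi] embeds polynomials in one variable along a coordinate axis. A nonzero c is a power of
    the variable times a polynomial with nonzero constant term, which becomes a unit, so the prime
    contains the variable. *)
Lemma prime_polyX (P : set A) (phi : {rmorphism {poly k} -> S}) (c : {poly k}) :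
    prime_ideal P -> (forall q, const_coef (phi q) = q`_0) ->
  c != 0 -> P (io (phi c)) -> P (io (phi 'X)).
Proof.
move=> [/idealr_closedP[P0 P1 PL] /prime_idealr_closedP pr] phi0.
have hP : ideal P by apply/idealP.
have [n] := ubnP (size c); elim: n c => // n IH c cn c0 Pc.
have [cc|cc] := eqVneq c`_0 0; last first.
  have [|b bE] := @to_loc_unit _ _ const_coef (phi c); first by move: cc; rewrite -(phi0 c).
  by exfalso; apply: P1; rewrite -bE; exact: idealM.
have cE : c = drop_poly 1 c * 'X by rewrite {1}(poly_split c) cc add0r.
move: Pc; rewrite cE !rmorphM => /pr[] // Pd.
have d0 : drop_poly 1 c != 0 by apply: contra_neq c0; rewrite {2}cE => ->; rewrite mul0r.
apply: IH Pd => //; rewrite -ltnS; apply: leq_trans cn.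
by rewrite {2}cE size_mulX.
Qed.

(** [prime_chain_coef] puts a nonzero polynomial in x alone into P2. Used after exchanging the
    variables, it gives one in y alone; [prime_polyX] then yields x and y. *)
Lemma prime_chain_max (P1 P2 : set A) :
    prime_ideal P1 -> prime_ideal P2 -> P1 `<` P2 -> (exists a, P1 a /\ a != 0) ->
  plane_max `<=` P2.
Proof.
move=> pP1 pP2 [P12 N12] [a [Pa a0]].
have [/idealr_closedP[P10 P11 P1L] /prime_idealr_closedP pr1] := pP1.
have [/idealr_closedP[P20 P21 P2L] _] := pP2.
have hP1 : ideal P1 by apply/idealP.
have hP2 : ideal P2 by apply/idealP.
have key (tau : {rmorphism S -> S}) : bijective tau ->
    exists c : {poly k}, c != 0 /\ P2 (io (tau c%:P)).
  move=> [tau' tauK tau'K].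
  apply: (@prime_chain_coef _ [set f | P1 (io (tau f))] [set f | P2 (io (tau f))]).
  - by move=> u v /=; rewrite !rmorphM; exact: pr1.
  - by apply/idealP; rewrite /= !rmorph0; split=> // c u v; rewrite !rmorphD !rmorphM; exact: P1L.
  - by apply/idealP; rewrite /= !rmorph0; split=> // c u v; rewrite !rmorphD !rmorphM; exact: P2L.
  - by move=> u; exact: P12.
  - have [f [g [g0 E]]] := locP a; exists (tau' f); rewrite /= tau'K; split.
      exact/(ideal_locE hP1 g0 E).
    apply: contra_neq a0 => /(congr1 tau); rewrite tau'K rmorph0 => f0.
    move/eqP: E; rewrite f0 rmorph0 mulf_eq0 to_loc_eq0 => /orP[/eqP //|/eqP g00].
    by rewrite g00 rmorph0 eqxx in g0.
  have [b Pb nPb] : exists2 b, P2 b & ~ P1 b.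
    by apply: contrapT => H; apply: N12 => b Pb; apply: contrapT => nb; apply: H; exists b.
  have [f [g [g0 E]]] := locP b; exists (tau' f); rewrite /= tau'K; split.
    exact/(ideal_locE hP2 g0 E).
  by move=> /(ideal_locE hP1 g0 E).
rewrite plane_max_gen; apply: (ideal_gen_sub hP2) => z; rewrite !inE => /orP[] /eqP ->.
  have [|c [c0 Pc]] := key idfun; first by exists idfun.
  by apply: (@prime_polyX P2 polyC c) => // q; rewrite /const_coef coefC.
have [|c [c0]] := key (@swapXY k); first by exists (@swapXY k); exact: swapXYK.
rewrite /= swapXY_polyC => Pc; rewrite -[X in io X](map_polyX polyC).
apply: (@prime_polyX P2 (map_poly polyC) c) => // q.
by rewrite /const_coef coef_map coefC.
Qed.

(** In a chain of length 3 the second prime is nonzero, so by [prime_chain_max] the third already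
    contains the maximal ideal and the last inclusion cannot be strict. *)
Lemma local_plane_dim : has_krull_dim A 2.
Proof.
have id_eps (g : S) : (idfun : {rmorphism S -> S}) g = 0 -> const_coef g = 0.
  by move=> /= ->; rewrite rmorph0.
have c0_eps (g : S) : (coefp 0 : {rmorphism S -> {poly k}}) g = 0 -> const_coef g = 0.
  by rewrite /= /const_coef => ->; rewrite coef0.
have mm_eps (g : S) : (const_coef : {rmorphism S -> k}) g = 0 -> const_coef g = 0 by [].
split.
  exists (fun i => if i is i'.+1 then if i' is 0 then loc_ker const_coef (coefp 0 : {rmorphism S -> {poly k}}) else plane_max
                   else loc_ker const_coef (idfun : {rmorphism S -> S})).
  split=> [[|[|i]] _|[|[|i]]] //; try exact: loc_ker_prime.
    move=> _; split=> [a [f [g [g0 E /= f0]]]|].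
      by exists f, g; split=> //; rewrite /= f0 coef0.
    move=> /(_ (io 'X)) H; have /(loc_ker_to id_eps)/eqP : loc_ker const_coef (idfun : {rmorphism S -> S}) (io 'X).
      by apply: H; apply/(loc_ker_to c0_eps); rewrite /= coefX.
    by rewrite /= polyX_eq0.
  move=> _; split=> [a [f [g [g0 E /= f0]]]|].
    by exists f, g; split=> //; exact: c0_eps.
  move=> /(_ (io 'X%:P)) H; have /(loc_ker_to c0_eps)/eqP : loc_ker const_coef (coefp 0 : {rmorphism S -> {poly k}}) (io 'X%:P).
    by apply: H; apply/(loc_ker_to mm_eps); rewrite /= /const_coef coefC coefX.
  by rewrite /= coefC /= polyX_eq0.
move=> n [N [pN sN]]; rewrite leqNgt; apply/negP => n2.
have [p0 p1 p2 p3] : [/\ prime_ideal (N 0), prime_ideal (N 1), prime_ideal (N 2) & prime_ideal (N 3)].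
  by split; apply: pN => //; apply: ltn_trans n2.
have s01 : N 0 `<` N 1 by apply: sN; apply: ltn_trans n2.
have s12 : N 1 `<` N 2 by apply: sN; apply: ltn_trans n2.
have [_ s23] : N 2 `<` N 3 by exact: sN.
apply: s23; apply: (@subset_trans _ plane_max); first exact: proper_sub_loc_max p3.1.
apply: (prime_chain_max p1 p2 s12).
have [_ s01'] := s01; apply: contrapT => H; apply: s01' => a Na.
have [/idealr_closedP[N00 _ _] _] := p0.
have [->//|a0] := eqVneq a 0; exfalso; apply: H; exists a; split=> //.
Qed.

Lemma regular_local_plane : regular_local_ring plane_max 2.
Proof.
split; [exact: noetherian_local_plane | exact: local_ring_loc | exact: local_plane_dim |].
exists [tuple io ('X%:P); io 'X]; exact: plane_max_gen.
Qed.

End LocalPlane.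

(** * Lengths *)

Section CompositionSeries.
Local Open Scope quotient_scope.
Variables (k : fieldType) (A : comNzRingType) (kap : {rmorphism k -> A}).

(** A composition series from I to J that also records why each factor is simple: J' / J is spanned
    over k by the class of e. The bound on chains uses these scalars. *)
Inductive comp_series (I : set A) : set A -> nat -> Prop :=
| CompNil of ideal I : comp_series I I 0
| CompCons J J' D e of comp_series I J D & ideal J' & J `<=` J' & J' e & ~ J e &
    (forall a, J' a -> exists c, J (a - kap c * e)) : comp_series I J' D.+1.

Lemma comp_series_sub I J D : comp_series I J D -> [/\ ideal I, ideal J & I `<=` J].
Proof.
elim=> [|J1 J2 D1 e _ [hI _ IJ] hJ2 J12 _ _ _]; first by split.
by split=> //; apply: subset_trans J12.
Qed.

Lemma comp_series_cat I J K D D' :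
  comp_series I J D -> comp_series J K D' -> comp_series I K (D + D').
Proof.
move=> cI; elim=> [_|J1 J2 D1 e _ IH hJ2 J12 J2e J1e H]; first by rewrite addn0.
by rewrite addnS; apply: (CompCons IH hJ2 J12 J2e J1e H).
Qed.

Definition ideal_chain (I J : set A) (l : nat) (N : nat -> set A) : Prop :=
  (forall i, (i <= l)%N -> [/\ ideal (N i), I `<=` N i & N i `<=` J]) /\
  (forall i, (i < l)%N -> N i `<` N i.+1).

Lemma comp_series_chain I J D : comp_series I J D -> exists N, ideal_chain I J D N.
Proof.
elim=> [hI|J1 J2 D1 e c1 [N [N1 N2]] hJ2 J12 J2e J1e H].
  by exists (fun=> I); split=> // i _; split.
have [hI hJ1 IJ] := comp_series_sub c1.
exists (fun i => if (i <= D1)%N then N i else J2); split=> i iD.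
  case: leqP => iD1; last by split=> //; apply: subset_trans J12.
  by have [] := N1 i iD1; split=> //; apply: subset_trans J12.
rewrite -ltnS iD; case: ltnP => iD1; first exact: N2.
have -> : i = D1 by apply/eqP; rewrite eqn_leq iD1 andbT -ltnS.
have [_ _ NJ] := N1 D1 (leqnn _).
split; first exact: subset_trans J12.
by move=> J2N; apply: J1e; apply: NJ; exact: J2N.
Qed.

Lemma chain_sub I J l N i j : ideal_chain I J l N -> (i <= j <= l)%N -> N i `<=` N j.
Proof.
move=> [_ sN] /andP[ij]; elim: j ij => [|j IH]; first by rewrite leqn0 => /eqP -> _ a.
rewrite leq_eqVlt => /orP[/eqP -> _ a //|ij jl].
by apply: (subset_trans (IH ij (ltnW jl))); case: (sN j jl).
Qed.

(* Intersecting with the penultimate term J1 of the series keeps every strict inclusion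
   of the chain, except the first one that leaves J1. *)
Lemma comp_series_bound I J D : comp_series I J D ->
  forall l N, ideal_chain I J l N -> (l <= D)%N.
Proof.
elim=> [hI|J1 J2 D1 e c1 IH hJ2 J12 J2e J1e H] l N hN.
  case: l hN => // l [N1 N2]; have [] := N2 0 isT => _; case.
  by have [_ _ h] := N1 1 isT; have [_ h' _] := N1 0 isT; apply: subset_trans h'.
case: l hN => // l hN; rewrite ltnS; have [N1 N2] := hN.
have [hI /[dup] hJ1 /idealP[J10 J1L] IJ] := comp_series_sub c1.
have [NJ|NJ] := pselect (N l.+1 `<=` J1).
  apply: ltnW; apply: (IH _ N); split=> // i il.
  have [? ? _] := N1 i il; split=> //; apply: subset_trans NJ.
  by apply: (chain_sub hN); rewrite il leqnn.
have ex : exists i, `[< ~ N i `<=` J1 >] by exists l.+1; apply/asboolP.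
case: (ex_minnP ex) => i0 /asboolP Ni0 min.
have i0l : (i0 <= l.+1)%N by apply: min; apply/asboolP.
have NJ1 i : (i < i0)%N -> N i `<=` J1.
  by move=> ii0; apply: contrapT => nNi; have := min i; rewrite leqNgt ii0 => /(_ _)/notF; apply; apply/asboolP.
(* From [i0] on, [N i] contains some u outside J1. Since J2 / J1 is a line, any a in [N i.+1] can be
   moved into J1 by a multiple of u, and this does not change whether a is in [N i]. *)
have strict i : (i0 <= i < l.+1)%N -> N i `&` J1 `<` N i.+1 `&` J1.
  move=> /andP[i0i il]; have [sub nsub] := N2 i il.
  split; first exact: setSI.
  move=> sub'; apply: nsub => a Na.
  have [u [Nu nJu]] : exists u, N i u /\ ~ J1 u.
    apply: contrapT => nex; apply: Ni0 => v Nv; apply: contrapT => nv; apply: nex.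
    by exists v; split=> //; apply: (chain_sub hN) Nv; rewrite i0i ltnW.
  have [/[dup] hNi /idealP[_ NL] _ NiJ2] := N1 i (ltnW il).
  have [hNi1 _ Ni1J2] := N1 i.+1 il.
  have [cu Hu] := H u (NiJ2 _ Nu); have [ca Ha] := H a (Ni1J2 _ Na).
  have cu0 : cu != 0.
    by apply/eqP => cu0; apply: nJu; rewrite cu0 rmorph0 mul0r subr0 in Hu.
  have := sub' (- kap (ca / cu) * u + a).
  case.
    split.
      by have /idealP[_ L] := hNi1; apply: L => //; exact: sub.
    have -> : - kap (ca / cu) * u + a = - kap (ca / cu) * (u - kap cu * e) + (a - kap ca * e).
      rewrite mulrBr mulNr [in RHS]mulNr mulrA -rmorphM divfK //.
      ring.
    exact: J1L.
  move=> Nv _; have -> : a = kap (ca / cu) * u + (- kap (ca / cu) * u + a) by ring.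
  exact: NL.
(* The term [N i0] is left out, so exactly one link is lost; at the seam, [N i0] intersected with J1
   serves as an intermediate step. *)
apply: (IH _ (fun j => if (j < i0)%N then N j else N j.+1 `&` J1)); split=> j jl.
  case: ltnP => ji0.
    by have [? ? _] := N1 j (leqW jl); split=> //; exact: NJ1.
  have [/idealP[h0 hL] IN NJ2] := N1 j.+1 jl; split.
  - apply/idealP; split; first by split.
    by move=> a u v [? ?] [? ?]; split; [exact: hL | exact: J1L].
  - by move=> a Ia; split; [exact: IN | exact: IJ].
  - by move=> a [].
case: (ltnP j.+1 i0) => [ji0|].
  by rewrite ltnW //; apply: N2; exact: leqW.
case: ltnP => [ji0|i0j _].
  move=> i0j; have ji : j.+1 = i0 by apply/eqP; rewrite eqn_leq ji0 i0j.
  have [|s1 s2] := strict j.+1; first by rewrite i0j ltnS.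
  have [sj _] := N2 j (leqW jl).
  have s3 : N j `<=` N j.+1 `&` J1 by move=> a Na; split; [exact: sj|exact: (NJ1 _ ji0)].
  split; first exact: subset_trans s1.
  by move=> s4; apply: s2; apply: subset_trans s3.
by apply: strict; rewrite (leq_trans i0j) // ltnS.
Qed.

(** Preimage and image under the projection match submodules of J / I with ideals between I and J.
    The series supplies a chain of length D, and [comp_series_bound] limits every other one. *)
Lemma module_length_comp_series (R : realType) (I : submodClosed A^o) (J : set A) D :
  comp_series [set` I] J D ->
  module_length R (\pi_(quotmod I) @` J) = D%:R%:E.
Proof.
move=> cs; have [hI hJ IJ] := comp_series_sub cs; have /idealP[J0 JL] := hJ.
have piE (a b : A^o) : \pi_(quotmod I) a = \pi_(quotmod I) b -> a - b \in I.
  by move=> /eqP; rewrite pi_quotmod_eq.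
have piD (c : A) (a b : A^o) : \pi_(quotmod I) (c *: a + b) = c *: \pi_(quotmod I) a + \pi_(quotmod I) b.
  by rewrite raddfD; congr (_ + _); exact: pi_quotmodZ.
apply/eqP; rewrite eq_le; apply/andP; split.
  apply: ub_ereal_sup => _ [n [N [N1 N2]] <-]; rewrite lee_fin ler_nat.
  apply: (comp_series_bound cs (N := fun i => [set a | N i (\pi_(quotmod I) a)])).
  split=> i il.
    have [/submoduleP[N0 NL] NJ] := N1 i il; split.
    - apply/idealP; split=> /=; first by rewrite raddf0.
      by move=> c u v Nu Nv; rewrite (piD c u v); exact: NL.
    - move=> a Ia /=; suff -> : \pi_(quotmod I) a = 0 by [].
      by rewrite -(raddf0 (\pi_(quotmod I))); apply/eqP; rewrite pi_quotmod_eq subr0.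
    - move=> a /= /NJ [b Jb /esym /piE Iab].
      by rewrite -(subrK b a) -[a - b]mul1r; apply: JL => //; exact: IJ.
  have [sub nsub] := N2 i il; split=> [a|sub']; first exact: sub.
  by apply: nsub => y; rewrite -[y]reprK; exact: sub'.
have [N [N1 N2]] := comp_series_chain cs.
apply: ereal_sup_ubound; exists D => //; exists (fun i => \pi_(quotmod I) @` N i); split=> i il.
  have [/idealP[N0 NL] IN NJ] := N1 i il; split; last exact: image_subset.
  apply/submoduleP; split; first by exists 0; rewrite ?raddf0.
  move=> c _ _ [u Nu <-] [v Nv <-]; exists (c * u + v); first exact: NL.
  exact: (piD c u v).
have [sub nsub] := N2 i il; split; first exact: image_subset.
move=> sub'; apply: nsub => a Na.
have [b Nb /esym /piE Iab] := sub' _ (imageP _ Na).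
have [/idealP[_ NL] IN _] := N1 i (ltnW il).
by rewrite -(subrK b a) -[a - b]mul1r; apply: NL => //; exact: IN.
Qed.

End CompositionSeries.

(** * Extending valuations to fractions *)

Lemma fraction_ratio (A : idomainType) (z : {fraction A}) :
  exists a b, b != 0 /\ z * tofrac b = tofrac a.
Proof.
elim/quotW: z => r; exists (frac r).1, (frac r).2; split; first exact: denom_ratioP.
rewrite /GRing.mul /= !piE; apply/eqmodP => /=.
by rewrite FracField.equivfE !numden_Ratio ?mulr1 ?oner_neq0 ?denom_ratioP // mulrC.
Qed.

Section LocalizationFractions.
Variables (S : idomainType) (k : fieldType) (eps : {rmorphism S -> k}).
Definition loc_frac (f : S) : {fraction (loc eps)} := tofrac (to_loc eps f).
Fact loc_frac_zmod_morphism : zmod_morphism loc_frac.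
Proof. by move=> f g; rewrite /loc_frac !rmorphB. Qed.
HB.instance Definition _ := GRing.isZmodMorphism.Build S {fraction (loc eps)} loc_frac loc_frac_zmod_morphism.
Fact loc_frac_monoid_morphism : monoid_morphism loc_frac.
Proof. by split=> [|f g]; rewrite /loc_frac ?rmorph1 ?rmorphM. Qed.
HB.instance Definition _ := GRing.isMonoidMorphism.Build S {fraction (loc eps)} loc_frac loc_frac_monoid_morphism.

Lemma loc_frac_inj : injective loc_frac.
Proof. by move=> f g /eqP; rewrite /loc_frac tofrac_eq => /eqP /to_loc_inj. Qed.

Lemma loc_fracP (z : {fraction (loc eps)}) :
  exists f g, g != 0 /\ z * loc_frac g = loc_frac f.
Proof.
have [a [c [c0 E]]] := fraction_ratio z.
have [f [g [g0 Ea]]] := locP a; have [f' [g' [g0' Ec]]] := locP c.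
have gn0 h : eps h != 0 -> h != 0 by move=> h0; apply: contra_neq h0 => ->; rewrite rmorph0.
exists (f * g'), (f' * g); split.
  have f'0 : f' != 0.
    apply: contra_neq c0 => f'0; move: Ec; rewrite f'0 rmorph0 => /eqP.
    by rewrite mulf_eq0 to_loc_eq0 (negbTE (gn0 _ g0')) orbF => /eqP.
  by rewrite mulf_neq0 // gn0.
by rewrite /loc_frac !rmorphM /= -Ea -Ec !rmorphM /= -E; ring.
Qed.

End LocalizationFractions.
Arguments loc_frac {S k} eps f.

Section ValuationExtension.
Variables (S : idomainType) (K : fieldType) (j : {rmorphism S -> K}).
Hypothesis j_inj : injective j.
Hypothesis jP : forall z, exists f g, g != 0 /\ z * j g = j f.
Variable o : S -> nat.
Hypothesis oM : forall f g, f != 0 -> g != 0 -> o (f * g) = (o f + o g)%N.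
Hypothesis oD : forall f g, f != 0 -> g != 0 -> f + g != 0 -> (minn (o f) (o g) <= o (f + g))%N.
Variable u : S.
Hypothesis u0 : u != 0.
Hypothesis ou : o u = 1%N.

Let num z := projT1 (cid (jP z)).
Let den z := projT1 (cid (projT2 (cid (jP z)))).
Let den0 z : den z != 0.
Proof. by rewrite /den; case: (cid (projT2 (cid (jP z)))) => g []. Qed.
Let numE z : z * j (den z) = j (num z).
Proof. by rewrite /num /den; case: (cid (projT2 (cid (jP z)))) => g []. Qed.

Let j0 f : (j f == 0) = (f == 0).
Proof. by rewrite -(rmorph0 j) (inj_eq j_inj). Qed.

Let num0 z : (num z == 0) = (z == 0).
Proof. by rewrite -j0 -numE mulf_eq0 j0 (negbTE (den0 z)) orbF. Qed.

Definition ext_val (z : K) : \bar int :=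
  if z == 0 then +oo%E else ((o (num z))%:Z - (o (den z))%:Z)%:E.

(** Independence of the chosen fraction: cross-multiply, return to S by injectivity of j, and apply
    [oM]. *)
Lemma ext_val_ratio z f g : f != 0 -> g != 0 -> z * j g = j f ->
  ext_val z = ((o f)%:Z - (o g)%:Z)%:E.
Proof.
move=> f0 g0 E; have z0 : z != 0.
  by apply: contra_neq f0 => z0; apply/eqP; rewrite -j0 -E z0 mul0r.
rewrite /ext_val (negbTE z0); congr (_%:E).
have /j_inj/(congr1 o) : j (f * den z) = j (num z * g) by rewrite !rmorphM /= -E -numE; ring.
by rewrite !oM ?num0 ?den0 //; lia.
Qed.

Let ratioP z : z != 0 -> exists f g, [/\ f != 0, g != 0 & z * j g = j f].
Proof.
by move=> z0; exists (num z), (den z); rewrite num0 z0 den0 numE.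
Qed.

Let ext_val0 : ext_val 0 = +oo%E. Proof. by rewrite /ext_val eqxx. Qed.

Let ext_val_fin z : z != 0 -> ext_val z \is a fin_num.
Proof. by rewrite /ext_val => /negbTE ->. Qed.

Let ext_valM y z : ext_val (y * z) = (ext_val y + ext_val z)%E.
Proof.
have [->|y0] := eqVneq y 0.
  rewrite mul0r ext_val0; have [->|/ext_val_fin] := eqVneq z 0; first by rewrite ext_val0.
  by case: (ext_val z).
have [->|z0] := eqVneq z 0.
  by rewrite mulr0 ext_val0; have := ext_val_fin y0; case: (ext_val y).
have [f [g [f0 g0 E]]] := ratioP y0; have [f' [g' [f0' g0' E']]] := ratioP z0.
rewrite (ext_val_ratio f0 g0 E) (ext_val_ratio f0' g0' E').
rewrite (@ext_val_ratio _ (f * f') (g * g')) ?mulf_neq0 //.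
  by rewrite !oM // -EFinD; congr (_%:E); lia.
by rewrite !rmorphM /= -E -E'; ring.
Qed.

Let ext_valD y z : (Order.min (ext_val y) (ext_val z) <= ext_val (y + z))%E.
Proof.
have [->|y0] := eqVneq y 0; first by rewrite add0r ge_min lexx orbT.
have [->|z0] := eqVneq z 0; first by rewrite addr0 ge_min lexx.
have [->|yz0] := eqVneq (y + z) 0; first by rewrite ext_val0 leey.
have [f [g [f0 g0 E]]] := ratioP y0; have [f' [g' [f0' g0' E']]] := ratioP z0.
have E2 : (y + z) * j (g * g') = j (f * g' + f' * g).
  by rewrite rmorphD !rmorphM /= -E -E'; ring.
have s0 : f * g' + f' * g != 0.
  by rewrite -j0 -E2 mulf_neq0 // j0 mulf_neq0.
rewrite (ext_val_ratio f0 g0 E) (ext_val_ratio f0' g0' E').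
rewrite (ext_val_ratio s0 (mulf_neq0 g0 g0') E2) ge_min !lee_fin.
have := oD (mulf_neq0 f0 g0') (mulf_neq0 f0' g0) s0.
rewrite (oM f0 g0') (oM f0' g0) (oM g0 g0'); move: (o (_ + _)) (o f) (o g) (o f') (o g') => t p q r s.
by rewrite geq_min => /orP[h|h]; apply/orP; [left|right]; lia.
Qed.

Let ext_val_surj (n : int) : exists z, ext_val z = n%:E.
Proof.
have on m : o (u ^+ m) = m.
  elim: m => [|m IH]; last by rewrite exprS oM ?expf_neq0 // IH ou.
  (* That o 1 = 0 comes from cancelling o u in o (u * 1) = o u + o 1. *)
  by have /eqP := oM u0 (oner_neq0 S); rewrite mulr1 expr0 -[X in X == _]addn0 eqn_add2l => /eqP <-.
have o1 : o 1 = 0%N by rewrite -(on 0%N) expr0.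
have ju0 m : j (u ^+ m) != 0 by rewrite j0 expf_neq0.
case: n => m.
  exists (j (u ^+ m)); rewrite (@ext_val_ratio _ (u ^+ m) 1) ?expf_neq0 ?oner_neq0 ?rmorph1 ?mulr1 //.
  by rewrite on o1 subr0.
exists (j (u ^+ m.+1))^-1; rewrite (@ext_val_ratio _ 1 (u ^+ m.+1)) ?expf_neq0 ?oner_neq0 //.
  by rewrite on o1 sub0r NegzE.
by rewrite rmorph1 mulVf.
Qed.

Definition extended_valuation : discrete_valuation K :=
  DiscreteValuation ext_val0 ext_val_fin ext_valM ext_valD ext_val_surj.

Lemma extended_valuation_ratio z f g : f != 0 -> g != 0 -> z * j g = j f ->
  extended_valuation z = ((o f)%:Z - (o g)%:Z)%:E.
Proof. exact: ext_val_ratio. Qed.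

End ValuationExtension.

Section LocalizationValuation.
Variables (S : idomainType) (k : fieldType) (eps : {rmorphism S -> k}).
Variable o : S -> nat.
Hypothesis oM : forall f g, f != 0 -> g != 0 -> o (f * g) = (o f + o g)%N.
Hypothesis oD : forall f g, f != 0 -> g != 0 -> f + g != 0 -> (minn (o f) (o g) <= o (f + g))%N.
Variable u : S.
Hypothesis u0 : u != 0.
Hypothesis ou : o u = 1%N.

Definition loc_valuation : discrete_valuation {fraction (loc eps)} :=
  extended_valuation (@loc_frac_inj _ _ eps) (@loc_fracP _ _ eps) oM oD u0 ou.

Lemma loc_valuationE (a : loc eps) f g : f != 0 -> g != 0 -> a * to_loc eps g = to_loc eps f ->
  loc_valuation (tofrac a) = ((o f)%:Z - (o g)%:Z)%:E.
Proof.
move=> f0 g0 E; apply: extended_valuation_ratio => //.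
by rewrite /= /loc_frac -E rmorphM.
Qed.

End LocalizationValuation.

(** * Value ideals of a valuation with leading forms *)

Section LeadingForms.
Variables (S : idomainType) (K L : fieldType).
Variables (eps : {rmorphism S -> K}) (cst : {rmorphism K -> S}) (phi : {rmorphism K -> L}).
(* [lam n f] stands for the initial form of f in degree n; it is only meaningful when f has
   value at least n, that is [lead_ge n f]. *)
Variable lam : nat -> S -> L.

Definition lead_ge (n : nat) (f : S) : Prop := forall j, (j < n)%N -> lam j f = 0.
Local Notation V := lead_ge.

Hypothesis lamD : forall n f h, lam n (f + h) = lam n f + lam n h.
Hypothesis lamC : forall n c f, lam n (cst c * f) = phi c * lam n f.
Hypothesis VM : forall n n' f h, V n f -> V n' h -> V (n + n') (f * h).
Hypothesis lamM : forall n n' f h, V n f -> V n' h -> lam (n + n') (f * h) = lam n f * lam n' h.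
Hypothesis lam_neq0 : forall f, f != 0 -> exists n, lam n f != 0.
Hypothesis lam_eps : forall f, lam 0 f = phi (eps f).
Variable X : S.
Hypothesis epsX : eps X = 0.
Hypothesis lamX : lam 1 X = 1.

Let lam0 n : lam n 0 = 0.
Proof. by rewrite -[0 in LHS](mul0r 0) -(rmorph0 cst) lamC rmorph0 mul0r. Qed.

Let lamN n f : lam n (- f) = - lam n f.
Proof. by apply/eqP; rewrite -addr_eq0 -lamD addNr lam0. Qed.

Let V0 f : V 0 f. Proof. by []. Qed.

Let VD n f h : V n f -> V n h -> V n (f + h).
Proof. by move=> Vf Vh j jn; rewrite lamD Vf // Vh // addr0. Qed.

Let Vle m n f : (m <= n)%N -> V n f -> V m f.
Proof. by move=> mn Vf j jm; apply: Vf; apply: leq_trans mn. Qed.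

Let VS n f : V n f -> lam n f = 0 -> V n.+1 f.
Proof.
by move=> Vf f0 j; rewrite ltnS leq_eqVlt => /orP[/eqP ->|] //; exact: Vf.
Qed.

Let lam0M n f h : V n h -> lam n (f * h) = lam 0 f * lam n h.
Proof. exact: (@lamM 0). Qed.

Let V0M n f h : V n h -> V n (f * h).
Proof. exact: (@VM 0). Qed.

Definition lead_value (f : S) : nat :=
  if pselect (exists n, lam n f != 0) is left h then ex_minn h else 0.
Local Notation value := lead_value.

Lemma lead_valueP f : f != 0 -> V (value f) f /\ lam (value f) f != 0.
Proof.
move=> /lam_neq0 h; rewrite /value; case: pselect => // {}h.
case: ex_minnP => n n0 min; split=> // m mn; apply/eqP/negPn/negP => /min.
by rewrite leqNgt mn.
Qed.

Lemma lead_geE n f : f != 0 -> V n f <-> (n <= value f)%N.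
Proof.
move=> /lead_valueP[Vf /eqP lf]; split=> [Vn|nf]; last exact: Vle Vf.
by rewrite leqNgt; apply/negP => /Vn.
Qed.

Lemma lead_value_eq n f : V n f -> lam n f != 0 -> value f = n.
Proof.
move=> Vf lf; have f0 : f != 0 by apply: contra_neq lf => ->; rewrite lam0.
apply/eqP; rewrite eqn_leq; apply/andP; split; last exact/lead_geE.
by rewrite leqNgt; apply/negP => /(lead_valueP f0).1 /eqP; apply/negP.
Qed.

Lemma lead_valueM f h : f != 0 -> h != 0 -> value (f * h) = (value f + value h)%N.
Proof.
move=> /lead_valueP[Vf lf] /lead_valueP[Vh lh]; apply: lead_value_eq; first exact: VM.
by rewrite lamM // mulf_neq0.
Qed.

Lemma lead_valueD f h : f != 0 -> h != 0 -> f + h != 0 ->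
  (minn (value f) (value h) <= value (f + h))%N.
Proof.
move=> f0 h0 fh0; apply/(lead_geE _ fh0); apply: VD.
  by apply/(lead_geE _ f0); rewrite geq_minl.
by apply/(lead_geE _ h0); rewrite geq_minr.
Qed.

Lemma lead_valueX : value X = 1%N.
Proof.
apply: lead_value_eq; last by rewrite lamX oner_neq0.
by move=> -[|//] _; rewrite lam_eps epsX rmorph0.
Qed.

Let X0 : X != 0.
Proof. by apply: contra_eq_neq lamX => ->; rewrite lam0 eq_sym oner_neq0. Qed.

Local Notation A := (loc eps).
Local Notation io := (to_loc eps).

Definition lead_valuation : discrete_valuation {fraction A} :=
  @loc_valuation _ _ eps value lead_valueM lead_valueD X X0 lead_valueX.
Local Notation nu := lead_valuation.

(** An admissible denominator h has value 0, because its form in degree 0 is phi (eps h), which is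
    nonzero. So the value of a is that of its numerator. *)
Lemma lead_valuation_ge n (a : A) f h : eps h != 0 -> a * io h = io f ->
  (n%:Z%:E <= nu (tofrac a))%E <-> V n f.
Proof.
move=> eh0 E; have h0 : h != 0 by apply: contra_neq eh0 => ->; rewrite rmorph0.
have [f0|f0] := eqVneq f 0.
  have -> : a = 0.
    move/eqP: E; rewrite f0 rmorph0 mulf_eq0 to_loc_eq0 => /orP[/eqP //|].
    by rewrite (negbTE h0).
  by rewrite f0 rmorph0 dval0 leey; split=> // _ j _; rewrite lam0.
have vh : value h = 0%N by apply: lead_value_eq => //; rewrite lam_eps fmorph_eq0.
rewrite /lead_valuation (loc_valuationE _ _ _ _ f0 h0 E) vh subr0 lee_fin lez_nat.
by split=> /(lead_geE _ f0).
Qed.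

Lemma lead_dominates : dominates (loc_max eps) nu.
Proof.
split=> [_ [a _ <-]|].
  have [f [h [h0 E]]] := locP a.
  by apply/(lead_valuation_ge 0 h0 E).
apply/seteqP; split=> a; have [f [h [h0 E]]] := locP a.
  move=> va; apply/(loc_maxE h0 E)/eqP; rewrite -(fmorph_eq0 phi) -lam_eps.
  apply/eqP; have /(lead_valuation_ge 1 h0 E) : (1%:Z%:E <= nu (tofrac a))%E; last exact.
  have {va} : (0 < nu (tofrac a))%E := va.
  by case: (dval nu (tofrac a)) => [z||] //; rewrite ?leey // lte_fin lee_fin.
move=> /(loc_maxE h0 E) f0; suff : (0 < nu (tofrac a))%E by [].
apply: (@lt_le_trans _ _ 1%:Z%:E); first by rewrite lte_fin.
by apply/(lead_valuation_ge 1 h0 E) => -[|//] _; rewrite lam_eps f0 rmorph0.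
Qed.

Definition lead_ideal (n : nat) : set A := [set a | (n%:Z%:E <= nu (tofrac a))%E].
Local Notation I := lead_ideal.

Lemma lead_idealE n a f h : eps h != 0 -> a * io h = io f -> I n a <-> V n f.
Proof. exact: lead_valuation_ge. Qed.

Lemma lead_ideal_to n f : I n (io f) <-> V n f.
Proof. by apply: (@lead_idealE _ _ _ 1); rewrite ?rmorph1 ?oner_neq0 ?mulr1. Qed.

Lemma lead_ideal_ideal n : ideal (I n).
Proof.
apply/idealP; split=> [|a v z].
  by rewrite -(rmorph0 io); apply/lead_ideal_to => j _; rewrite lam0.
have [p [q [q0 Ea]]] := locP a.
have [f [h [h0 Ev]]] := locP v; have [f' [h' [h0' Ez]]] := locP z.
move=> /(lead_idealE n h0 Ev) Vf /(lead_idealE n h0' Ez) Vf'.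
have d0 : eps (q * h * h') != 0 by rewrite !rmorphM !mulf_neq0.
have E : (a * v + z) * io (q * h * h') = io (p * h' * f + q * h * f').
  by rewrite rmorphD !rmorphM /= -Ea -Ev -Ez; ring.
by apply/(lead_idealE n d0 E); apply: VD; exact: V0M.
Qed.

Let numer (a : A) : S := projT1 (cid (locP a)).
Let denom (a : A) : S := projT1 (cid (projT2 (cid (locP a)))).
Let denom0 a : eps (denom a) != 0.
Proof. by rewrite /denom; case: (cid (projT2 (cid (locP a)))) => h []. Qed.
Let numerE a : a * io (denom a) = io (numer a).
Proof. by rewrite /numer /denom; case: (cid (projT2 (cid (locP a)))) => h []. Qed.

(** For a in I_n this represents the class of a / X^n in the residue field of the valuation. By
    [loc_leadE] the choice of fraction does not matter on I_n. *)
Definition loc_lead (n : nat) (a : A) : L := lam n (numer a) / lam 0 (denom a).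

Let lamd0 h : eps h != 0 -> lam 0 h != 0.
Proof. by move=> h0; rewrite lam_eps fmorph_eq0. Qed.

Lemma loc_leadE n a f h : eps h != 0 -> a * io h = io f -> V n f ->
  loc_lead n a = lam n f / lam 0 h.
Proof.
move=> h0 E Vf.
have Vn : V n (numer a) by apply/(lead_idealE n (denom0 a) (numerE a))/(lead_idealE n h0 E).
have EE : h * numer a = denom a * f.
  by apply: (@to_loc_inj _ _ eps); rewrite !rmorphM /= -numerE -E; ring.
rewrite /loc_lead; apply/eqP; rewrite eqr_div ?lamd0 //.
by rewrite mulrC -lam0M // EE lam0M // mulrC.
Qed.

Lemma loc_lead_to n f : V n f -> loc_lead n (io f) = lam n f.
Proof.
move=> Vf; rewrite (@loc_leadE n _ f 1) ?rmorph1 ?oner_neq0 ?mulr1 //.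
by rewrite lam_eps !rmorph1 divr1.
Qed.

(** The scalar c is the residue of a. So A acts on I_n / I_(n+1) through K, which is why length over
    A becomes dimension over K. *)
Lemma loc_lead_linear n a v z : I n v -> I n z ->
  exists c, loc_lead n (a * v + z) = phi c * loc_lead n v + loc_lead n z.
Proof.
have [p [q [q0 Ea]]] := locP a.
have [f [h [h0 Ev]]] := locP v; have [f' [h' [h0' Ez]]] := locP z.
move=> /(lead_idealE n h0 Ev) Vf /(lead_idealE n h0' Ez) Vf'.
exists (eps p / eps q).
rewrite (loc_leadE h0 Ev Vf) (loc_leadE h0' Ez Vf').
have d0 : eps (q * h * h') != 0 by rewrite !rmorphM !mulf_neq0.
have Vs : V n (p * h' * f + q * h * f') by apply: VD; exact: V0M.
rewrite (@loc_leadE n (a * v + z) _ _ d0 _ Vs); last first.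
  by rewrite rmorphD !rmorphM /= -Ea -Ev -Ez; ring.
rewrite lamD !lam0M // !lam_eps !rmorphM fmorphV /=; field.
by rewrite !fmorph_eq0 q0 h0 h0'.
Qed.

Lemma lead_idealS n a : I n.+1 a <-> I n a /\ loc_lead n a = 0.
Proof.
have [f [h [h0 E]]] := locP a.
rewrite (lead_idealE n.+1 h0 E) (lead_idealE n h0 E); split=> [Vf|[Vf]].
  have Vn : V n f by apply: Vle Vf.
  by split=> //; rewrite (loc_leadE h0 E Vn) Vf // mul0r.
rewrite (loc_leadE h0 E Vf) => /eqP; rewrite mulf_eq0 invr_eq0 (negbTE (lamd0 h0)) orbF => /eqP.
exact: VS.
Qed.

Definition loc_cst : {rmorphism K -> A} := io \o cst.

Lemma loc_lead_sub n c v z : I n v -> I n z ->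
  loc_lead n (z - loc_cst c * v) = loc_lead n z - phi c * loc_lead n v.
Proof.
have [f [h [h0 Ev]]] := locP v; have [f' [h' [h0' Ez]]] := locP z.
move=> /(lead_idealE n h0 Ev) Vf /(lead_idealE n h0' Ez) Vf'.
rewrite (loc_leadE h0 Ev Vf) (loc_leadE h0' Ez Vf').
have d0 : eps (h * h') != 0 by rewrite !rmorphM !mulf_neq0.
have VNf : V n (- (cst c * (h' * f))) by move=> j jn; rewrite lamN lamC (V0M h' Vf jn) mulr0 oppr0.
have Vs : V n (h * f' + - (cst c * (h' * f))) by apply: VD => //; exact: V0M.
rewrite (@loc_leadE n _ _ _ d0 _ Vs); last first.
  by rewrite /loc_cst rmorphB !rmorphM /= -Ev -Ez; ring.
rewrite lamD lamN lamC !lam0M // !lam_eps; field.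
by rewrite !fmorph_eq0 h0 h0'.
Qed.

Variables (D : nat -> nat) (e : nat -> nat -> S) (gm : nat -> L).
Hypothesis eV : forall n m, (m < D n)%N -> V n (e n m).
Hypothesis e_lam : forall n m, (m < D n)%N -> lam n (e n m) = gm m.
Hypothesis lam_span : forall n f, exists c : nat -> K, lam n f = \sum_(m < D n) phi (c m) * gm m.
Hypothesis gm_free : forall N (c : nat -> K),
  \sum_(m < N) phi (c m) * gm m = 0 -> forall m, (m < N)%N -> c m = 0.

(** Filter I_n by the ideals [J i] of elements whose form lies in the span of the first i products
    [gm m]. The step from [J i] to [J i.+1] is spanned by [e n i], whose form [gm i] is independent
    of the earlier ones. *)
Lemma lead_comp_series n : comp_series loc_cst (I n.+1) (I n) (D n).
Proof.
pose J i : set A := [set a | I n a /\ exists c : nat -> K, loc_lead n a = \sum_(m < i) phi (c m) * gm m].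
have /idealP[I0 IL] := lead_ideal_ideal n.
have hJ i : ideal (J i).
  apply/idealP; split.
    split=> //; exists (fun=> 0); rewrite big1; last by move=> m _; rewrite rmorph0 mul0r.
    by have /lead_idealS[] : I n.+1 0 by case/idealP: (lead_ideal_ideal n.+1).
  move=> a v z [Iv [c cE]] [Iz [d dE]]; split; first exact: IL.
  have [r ->] := loc_lead_linear a Iv Iz; exists (fun m => r * c m + d m).
  rewrite cE dE big_distrr -big_split; apply: eq_bigr => m _ /=.
  by rewrite rmorphD rmorphM; ring.
suff H i : (i <= D n)%N -> comp_series loc_cst (I n.+1) (J i) i.
  suff -> : I n = J (D n) by exact: H.
  apply/seteqP; split=> [a Ia|a []//]; split=> //.
  have [f [h [h0 E]]] := locP a; have /(lead_idealE n h0 E) Vf := Ia.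
  have [c cE] := lam_span n f; exists (fun m => c m / eps h).
  rewrite (loc_leadE h0 E Vf) cE big_distrl lam_eps; apply: eq_bigr => m _ /=.
  by rewrite fmorph_div mulrAC.
elim: i => [_|i IH iD].
  suff <- : I n.+1 = J 0%N by apply: CompNil; exact: lead_ideal_ideal.
  apply/seteqP; split=> [a /lead_idealS[Ia a0]|a [Ia [c]]].
    by split=> //; exists (fun=> 0); rewrite big_ord0.
  by rewrite big_ord0 => a0; apply/lead_idealS.
have Ie : I n (io (e n i)) by apply/lead_ideal_to; exact: eV.
have le : loc_lead n (io (e n i)) = gm i.
  by rewrite loc_lead_to ?e_lam //; exact: eV.
apply: (CompCons (IH (ltnW iD)) (hJ _) (e := io (e n i))).
- move=> a [Ia [c cE]]; split=> //; exists (fun m => if m == i then 0 else c m).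
  rewrite big_ord_recr /= eqxx rmorph0 mul0r addr0 cE; apply: eq_bigr => m _.
  by rewrite ltn_eqF.
- split=> //; exists (fun m => (m == i)%:R).
  rewrite le big_ord_recr /= eqxx rmorph1 mul1r big1 ?add0r // => m _.
  by rewrite ltn_eqF // rmorph0 mul0r.
- move=> [_ [c]]; rewrite le => E.
  have := @gm_free i.+1 (fun m => if m == i then 1 else - c m) _ i (ltnSn i).
  rewrite eqxx => /(_ _)/eqP; rewrite oner_eq0 => H; apply: notF; apply: H.
  rewrite big_ord_recr /= eqxx rmorph1 mul1r E -big_split big1 // => m _ /=.
  by rewrite ltn_eqF // rmorphN mulNr addNr.
move=> a [Ia [c cE]]; exists (c i); split.
  rewrite addrC -mulNr; apply: IL => //.
exists c; rewrite loc_lead_sub // le cE big_ord_recr /=.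
by rewrite addrK.
Qed.

Lemma lead_comp_series_quotient n : comp_series loc_cst (I n) (I 0) (\sum_(j < n) D j).
Proof.
elim: n => [|n IH]; first by rewrite big_ord0; apply: CompNil; exact: lead_ideal_ideal.
by rewrite big_ord_recr /= addnC; apply: comp_series_cat (lead_comp_series n) IH.
Qed.

Lemma lead_value_idealE n : [set` value_ideal lead_dominates n] = I n.
Proof. by apply/seteqP; split. Qed.

Theorem lead_length_graded (R : realType) n :
  length_graded lead_dominates R n = (D n)%:R%:E.
Proof.
rewrite /length_graded lead_value_idealE; apply: (module_length_comp_series R (kap := loc_cst)).
by rewrite lead_value_idealE; exact: lead_comp_series.
Qed.

Theorem lead_length_quotient (R : realType) n :
  length_quotient lead_dominates R n = (\sum_(j < n) D j)%:R%:E.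
Proof.
have cs : comp_series loc_cst [set` value_ideal lead_dominates n] (I 0) (\sum_(j < n) D j).
  by rewrite lead_value_idealE; exact: lead_comp_series_quotient.
rewrite /length_quotient -(module_length_comp_series R cs).
congr module_length; apply/seteqP; split=> // y _.
rewrite -[y]reprK; exists (repr y) => //.
have [f [h [h0 E]]] := locP (repr y).
by apply/(lead_idealE 0 h0 E).
Qed.

End LeadingForms.

(** * The valuation on the plane and its lengths *)

Section PlaneValuation.
Variables (K L : fieldType) (phi : {rmorphism K -> L}).
Variables (u : nat -> K) (g : nat -> L).
Hypothesis g_sqr : forall i, g i ^+ 2 = phi (u i).
Local Notation gm := (bigbit *%R g).
Hypothesis gm_free : forall N (c : nat -> K),
  \sum_(m < N) phi (c m) * gm m = 0 -> forall m, (m < N)%N -> c m = 0.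
Variable b : nat -> nat.
Hypothesis b0_gt0 : (0 < b 0)%N.
Hypothesis b_double : forall i, ((b i).*2 < b i.+1)%N.
Local Notation lam := (leadform phi u g b).
Local Notation V := (value_ge phi u g b).
Local Notation D := (wcount b0_gt0 b_double).

(** The basis element Q_m raised to value exactly n by a power of x, which is possible precisely for
    w m <= n; these represent the basis of I_n / I_(n+1). *)
Definition keymono (n m : nat) : {poly {poly K}} := (polyC 'X) ^+ (n - weight b m) * keyprod u b m.

Lemma keymonoV n m : (m < D n)%N -> V n (keymono n m).
Proof.
rewrite -weight_leq => le; rewrite -[X in V X _](subnK le).
by apply: value_geX => // j jw; rewrite leadform_keyprod // gtn_eqF.
Qed.

Lemma keymono_lam n m : (m < D n)%N -> lam n (keymono n m) = gm m.
Proof.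
rewrite -weight_leq => le; rewrite -[X in leadform _ _ _ _ X _](subnK le).
by rewrite /keymono leadformXn // leadform_keyprod // eqxx.
Qed.

Lemma leadform_span n f : exists c : nat -> K, lam n f = \sum_(m < D n) phi (c m) * gm m.
Proof.
exists (fun m => wcoef u b f m n).
have Dn : (D n <= n.+1)%N by rewrite leqNgt -weight_leq -ltnNge; exact: leq_weight.
rewrite /leadform -(big_mkord xpredT (fun m => phi (wcoef u b f m n) * gm m)).
rewrite (@big_cat_nat _ _ _ (D n)) //= big_mkord [X in _ + X]big1_seq ?addr0 // => m.
rewrite mem_index_iota => /andP[_ /andP[Dm _]].
by rewrite /wcoef weight_leq ltnNge Dm /= rmorph0 mul0r.
Qed.

Definition const_coef_morph : {rmorphism {poly {poly K}} -> K} := @const_coef K.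
Definition polyCC : {rmorphism K -> {poly {poly K}}} := polyC \o polyC.

Let lamM := @leadformM _ _ _ _ _ g_sqr gm_free _ b0_gt0 b_double.
Let VM := @value_geM _ _ _ _ _ g_sqr gm_free _ b0_gt0 b_double.

Theorem plane_valuation_lengths :
  exists (A : idomainType) (m : set A) (nu : discrete_valuation {fraction A}) (dom : dominates m nu),
    regular_local_ring m 2 /\ forall (R : realType) n,
      length_graded dom R n = (D n)%:R%:E /\
      length_quotient dom R n = (\sum_(j < n) D j)%:R%:E.
Proof.
have lamX : lam 1 (polyC 'X) = 1.
  rewrite -[polyC 'X]mulr1 leadformX //.
  by have := leadform_keyprod phi u g b0_gt0 b_double 0 0; rewrite weight0 eqxx keyprod0 => ->; exact: bigbit0.
have lamD n f h : lam n (f + h) = lam n f + lam n h by exact: leadformD.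
have lamC n c f : lam n (polyCC c * f) = phi c * lam n f by exact: leadformC.
have lamn0 (f : {poly {poly K}}) : f != 0 -> exists n, lam n f != 0 by exact: (leadform_neq0 u gm_free b0_gt0 b_double).
have lame (f : {poly {poly K}}) : lam 0 f = phi (const_coef_morph f).
  exact: (leadform_const g_sqr gm_free b0_gt0 b_double).
have epsX : const_coef_morph (polyC 'X) = 0 by rewrite /= /const_coef coefC coefX.
refine (ex_intro _ _ (ex_intro _ _ (ex_intro _ _
  (ex_intro _ (lead_dominates lamD lamC VM lamM lamn0 lame epsX lamX) _)))).
split; first exact: regular_local_plane.
move=> R n; split.
  exact: (lead_length_graded _ _ _ _ _ _ _ _ keymonoV keymono_lam leadform_span gm_free).
exact: (lead_length_quotient _ _ _ _ _ _ _ _ keymonoV keymono_lam leadform_span gm_free).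
Qed.
End PlaneValuation.

(** * Quasi-polynomials *)

Lemma PoszMn (m n : nat) : Posz (m * n) = m%:Z *+ n.
Proof. by rewrite PoszM -[X in _ * X]natz mulr_natr. Qed.

Section Sequences.
Variable R : realType.

Lemma nat_bound (a : R) : exists n : nat, a <= n%:R.
Proof.
by exists (Num.truncn `|a|).+1; apply: ltW; apply: le_lt_trans (ler_norm a) _; case/andP: (truncn_itv (normr_ge0 a)).
Qed.

Lemma div_small (a e : R) : 0 < e -> exists N : nat, forall j, (N <= j)%N -> a <= e * j%:R.
Proof.
move=> e0; have [N HN] := nat_bound (a / e); exists N => j Nj.
rewrite mulrC -ler_pdivrMr //; apply: le_trans HN _; by rewrite ler_nat.
Qed.

(** If h(j) tends to c, then (h - h(0)) / X is a smaller polynomial with limit 0, hence zero by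
    induction. *)
Lemma poly_cvg_const (h : {poly R}) (c : R) :
  (forall e, 0 < e -> exists N : nat, forall j : nat, (N <= j)%N -> `|h.[j%:R] - c| <= e) ->
  h = c%:P.
Proof.
have [n] := ubnP (size h); elim: n h c => // n IH h c sh H.
have hE := poly_split h; set p := drop_poly 1 h in hE.
have p0 : p = 0%:P.
  have [p0|pn0] := eqVneq p 0; first by rewrite p0.
  apply: IH.
    apply: leq_ltn_trans (_ : ((size h).-1 < n)%N); first by rewrite size_drop_poly subn1.
    have : (0 < size h)%N; last by move: sh; case: (size h).
    by rewrite size_poly_gt0; apply: contra_neq pn0 => h0; rewrite /p h0 drop_poly0r.
  move=> e e0; have [N HN] := H 1 ltr01.
  have [N' HN'] := div_small (1 + `|c - h`_0|) e0.
  exists (maxn 1 (maxn N N')) => j; rewrite !geq_max => /and3P[j0 Nj N'j].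
  have jR : 0 < j%:R :> R by rewrite ltr0n.
  rewrite subr0 -(ler_pM2r jR) -[X in _ * X <= _](ger0_norm (ltW jR)) -normrM.
  have -> : p.[j%:R] * j%:R = (h.[j%:R] - c) + (c - h`_0).
    have -> : h.[j%:R] = h`_0 + p.[j%:R] * j%:R.
      by rewrite {1}hE hornerD hornerC hornerM hornerX.
    by ring.
  by apply: le_trans (HN' j N'j); apply: le_trans (ler_normD _ _) _; rewrite lerD2r HN.
have {}hE : h = (h`_0)%:P by rewrite {1}hE p0 polyC0 mul0r addr0.
rewrite hE; congr (_%:P); apply/eqP; rewrite -subr_eq0 -normr_le0.
apply/ler_addgt0Pl => e e0; rewrite addr0.
by have [N /(_ N (leqnn _))] := H e e0; rewrite {1}hE hornerC.
Qed.

(** The growth bounds make h = q - C p X sublinear at the integers, hence constant, so r stays near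
    C n on the multiples of p. Monotonicity carries this to the integers in between. *)
Lemma bounded_of_poly (r : nat -> R) (C : R) (p : nat) (q : {poly R}) (M : R) (N : nat) :
    0 <= C -> (0 < p)%N -> (forall m n, (m <= n)%N -> r m <= r n) ->
    (forall n, C * n%:R <= r n) ->
    (forall e, 0 < e -> exists K, forall n, r n <= (C + e) * n%:R + K) ->
    (forall j, (N <= j)%N -> `|r (p * j)%N - q.[j%:R]| <= M) ->
  exists B, forall n, r n - C * n%:R <= B.
Proof.
move=> C0 p0 mono lo up near.
have pR : 0 < p%:R :> R by rewrite ltr0n.
have M0 : 0 <= M by apply: le_trans (near N (leqnn _)).
pose h := q - (C * p%:R) *: 'X.
have hE j : h.[j%:R] = q.[j%:R] - C * (p * j)%N%:R.
  by rewrite /h hornerD hornerN hornerZ hornerX natrM mulrA.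
have p1 : drop_poly 1 h = 0%:P.
  apply: poly_cvg_const => e e0;
  have e1 : 0 < e / 2 / p%:R by rewrite !divr_gt0.
  have [K HK] := up _ e1.
  have e2 : 0 < e / 2 by rewrite divr_gt0.
  have [N' HN'] := div_small (`|K| + M + `|h`_0|) e2.
  exists (maxn 1 (maxn N N')) => j; rewrite !geq_max => /and3P[j0 Nj N'j].
  have jR : 0 < j%:R :> R by rewrite ltr0n.
  rewrite subr0 -(ler_pM2r jR) -[X in _ * X <= _](ger0_norm (ltW jR)) -normrM.
  have -> : (drop_poly 1 h).[j%:R] * j%:R = h.[j%:R] - h`_0.
    have -> : h.[j%:R] = h`_0 + (drop_poly 1 h).[j%:R] * j%:R.
      by rewrite {1}(poly_split h) hornerD hornerC hornerM hornerX.
    by ring.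
  have hn := near j Nj; have l := lo (p * j)%N; have u := HK (p * j)%N.
  have a1 : `|r (p * j)%N - C * (p * j)%N%:R| <= e / 2 * j%:R + `|K|.
    have K1 := ler_norm K; have K0 := normr_ge0 K.
    have E : e / 2 / p%:R * (p * j)%N%:R = e / 2 * j%:R.
      by rewrite natrM mulrA divfK // gt_eqF.
    have ej : 0 <= e / 2 * j%:R by rewrite mulr_ge0 // ltW.
    rewrite ler_norml; apply/andP; split; first by lra.
    move: u; rewrite mulrDl E; lra.
  apply: le_trans (ler_normB _ _) _.
  have : `|h.[j%:R]| <= M + (e / 2 * j%:R + `|K|).
    rewrite hE (_ : _ - _ = (q.[j%:R] - r (p * j)%N) + (r (p * j)%N - C * (p * j)%N%:R)); last by ring.
    by apply: le_trans (ler_normD _ _) _; rewrite lerD // distrC.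
  by have := HN' j N'j; lra.
have {p1} hc : h = (h`_0)%:P by rewrite {1}(poly_split h) p1 polyC0 mul0r addr0.
have big j : (N <= j)%N -> r (p * j)%N - C * (p * j)%N%:R <= M + `|h`_0|.
  move=> Nj; have := near j Nj; have := hE j; rewrite hc hornerC coefC /= => E.
  rewrite ler_norml => /andP[_]; have := ler_norm h`_0; lra.
(* The first bound covers n <= p N. Beyond it, r n is compared with the next multiple of p, at
   distance at most p, which costs C p. *)
exists (Num.max (r (p * N)%N) (M + `|h`_0| + C * p%:R)) => n.
rewrite le_max; have [nN|Nn] := leqP n (p * N).
  apply/orP; left; rewrite lerBlDr; apply: le_trans (mono _ _ nN) _.
  by rewrite lerDl mulr_ge0.
apply/orP; right.
have nlt : (n <= p * (n %/ p).+1)%N by rewrite mulnC ltnW // ltn_ceil.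
have nge : (p * (n %/ p).+1 <= n + p)%N by rewrite mulnS mulnC addnC leq_add2r leq_trunc_div.
have Nj : (N <= (n %/ p).+1)%N by rewrite ltnW // ltnS leq_divRL // mulnC ltnW.
have := big _ Nj; have := mono _ _ nlt.
have : C * (p * (n %/ p).+1)%N%:R <= C * (n%:R + p%:R) by rewrite ler_wpM2l // -natrD ler_nat.
lra.
Qed.

(** Modulo a common period of the coefficients, every residue class freezes them, and the
    quasi-polynomial becomes an honest polynomial in j. *)
Lemma quasi_poly_progression (f : nat -> \bar R) (r : nat -> R) :
    (forall n, f n = (r n)%:E) -> quasi_polynomial_plus_bounded f ->
  exists p : nat, (0 < p)%N /\ forall s : nat, exists (q : {poly R}) (M : R) (N : nat),
    forall j, (N <= j)%N -> `|r (p * j + s)%N - q.[j%:R]| <= M.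
Proof.
move=> fE [Q [sig [n0 [[d [a [per QE]]] bd H]]]].
have [M HM] : exists M, forall z : int, `|sig z| <= M.
  by case: bd => M [Mr HM]; exists (M + 1) => z; apply: (HM (M + 1)) => //; rewrite ltrDl.
have perN i : (i <= d)%N -> exists2 p : nat, (0 < p)%N & periodic (a i) p%:Z.
  by move=> /per [[p|p] // p0 ap]; exists p.
have [p p0 Hp] : exists2 p : nat, (0 < p)%N & forall i, (i <= d)%N -> periodic (a i) p%:Z.
  elim: {QE per} d perN => [|d IH] perN.
    by have [p p0 Hp] := perN 0%N isT; exists p => // i; rewrite leqn0 => /eqP ->.
  have [p p0 Hp] := IH (fun i h => perN i (leqW h)).
  have [p' p0' Hp'] := perN d.+1 (leqnn _).
  exists (p * p')%N; first by rewrite muln_gt0 p0.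
  move=> i; rewrite leq_eqVlt => /orP[/eqP -> z|id z].
    by rewrite mulnC PoszMn; exact: periodicn.
  by rewrite PoszMn; apply: periodicn; exact: Hp.
exists p; split=> // s.
exists (\sum_(i < d.+1) a i s%:Z *: (p%:R *: 'X + s%:R%:P) ^+ i), M, n0 => j nj.
have le : (n0 <= p * j + s)%N.
  by apply: leq_trans nj _; apply: leq_trans (leq_addr _ _); rewrite leq_pmull.
have := H _ le; rewrite fE => -[->]; rewrite QE horner_sum.
rewrite (eq_bigr (fun i : 'I_d.+1 => (a i s%:Z *: (p%:R *: 'X + s%:R%:P) ^+ i).[j%:R])).
  by rewrite addrAC subrr add0r.
move=> i _; rewrite hornerZ horner_exp hornerD hornerZ hornerX hornerC -natrM -natrD; congr (_ * _).
have -> : Posz (p * j + s) = s%:Z + p%:Z *+ j.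
  by rewrite PoszD addrC PoszMn.
by rewrite periodicn //; apply: Hp; rewrite -ltnS.
Qed.

End Sequences.

(** * Growth of the lengths *)

Section GrowthOfCounts.
Variables (R : realType) (C : R) (D : nat -> nat).
Hypothesis C0 : 0 <= C.
Hypothesis D_mono : forall m n, (m <= n)%N -> (D m <= D n)%N.
Hypothesis D_lower : forall n, C * n%:R <= (D n)%:R.
Hypothesis D_upper : forall e, 0 < e -> exists K, forall n, (D n)%:R <= (C + e) * n%:R + K.
Hypothesis D_unbounded : forall B, exists n, B < (D n)%:R - C * n%:R.

Lemma count_not_quasi_poly (f : nat -> \bar R) :
  (forall n, f n = (D n)%:R%:E) -> ~ quasi_polynomial_plus_bounded f.
Proof.
move=> fE /(quasi_poly_progression fE)[p [p0 /(_ 0%N)[q [M [N H]]]]].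
have [B HB] : exists B, forall n, (D n)%:R - C * n%:R <= B.
  apply: (@bounded_of_poly R (fun n => (D n)%:R) C p q M N) => //.
    by move=> m n mn; rewrite ler_nat D_mono.
  by move=> j Nj; have := H j Nj; rewrite addn0.
by have [n] := D_unbounded B; rewrite ltNge HB.
Qed.

(** Consecutive partial sums differ by a value of D. Subtracting the polynomials for the classes of
    0 and 1 puts D(p j) within bounded distance of a polynomial, and the argument for D itself
    applies. *)
Lemma count_sum_not_quasi_poly (f : nat -> \bar R) :
  (forall n, f n = (\sum_(j < n) D j)%:R%:E) -> ~ quasi_polynomial_plus_bounded f.
Proof.
move=> fE /(quasi_poly_progression fE)[p [p0 H]].
have [q0 [M0 [N0 H0]]] := H 0%N; have [q1 [M1 [N1 H1]]] := H 1%N.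
have [B HB] : exists B, forall n, (D n)%:R - C * n%:R <= B.
  apply: (@bounded_of_poly R (fun n => (D n)%:R) C p (q1 - q0) (M1 + M0) (maxn N0 N1)) => //.
    by move=> m n mn; rewrite ler_nat D_mono.
  move=> j; rewrite geq_max => /andP[/H0 h0 /H1 h1].
  rewrite hornerD hornerN (_ : _ - _ =
    ((\sum_(i < p * j + 1) D i)%:R - q1.[j%:R]) - ((\sum_(i < p * j + 0) D i)%:R - q0.[j%:R])).
    by apply: le_trans (ler_normB _ _) _; exact: lerD.
  by rewrite addn1 addn0 big_ord_recr /= natrD; ring.
by have [n] := D_unbounded B; rewrite ltNge HB.
Qed.

Lemma cvg_EFin_nat (v : nat -> R) (l : R) :
    (forall e, 0 < e -> exists N : nat, forall n, (N <= n)%N -> `|l - v n| <= e) ->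
  ((v n)%:E @[n --> \oo] --> l%:E)%E.
Proof.
move=> H; apply: cvg_EFin; first exact: nearW.
apply/cvgrPdist_le => e e0; have [N HN] := H e e0.
by exists N.
Qed.

Lemma count_cvg : (((D n)%:R%:E * (n%:R^-1)%:E)%E @[n --> \oo] --> C%:E)%E.
Proof.
apply: (@cvg_EFin_nat (fun n => (D n)%:R * n%:R^-1)) => e e0.
have e2 : 0 < e / 2 by rewrite divr_gt0.
have [K HK] := D_upper e2; have [N HN] := div_small K e2.
exists (maxn 1 N) => n; rewrite geq_max => /andP[n0 Nn].
have nR : 0 < n%:R :> R by rewrite ltr0n.
rewrite -(ler_pM2r nR) -[X in _ * X <= _](ger0_norm (ltW nR)) -normrM mulrBl divfK ?gt_eqF //.
rewrite distrC ger0_norm ?subr_ge0 //.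
by have := HK n; have := HN n Nn; lra.
Qed.

Lemma count_sum_cvg :
  (((\sum_(j < n) D j)%:R%:E * ((n%:R ^+ 2)^-1)%:E)%E @[n --> \oo] --> (C / 2)%:E)%E.
Proof.
apply: (@cvg_EFin_nat (fun n => (\sum_(j < n) D j)%:R * (n%:R ^+ 2)^-1)) => e e0.
have [K HK] := D_upper e0.
have [N HN] := @div_small R (`|K| * 2 + C) e e0.
exists (maxn 1 N) => n; rewrite geq_max => /andP[n0 Nn].
have nR : 0 < n%:R :> R by rewrite ltr0n.
have n2 : 0 < n%:R ^+ 2 :> R by rewrite exprn_gt0.
(* n^2 - n is twice the sum of the j < n, so this and [up] are the bounds on D summed term by
   term. *)
have lo : C * (n%:R ^+ 2 - n%:R) <= 2 * (\sum_(j < n) D j)%:R.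
  elim: {n0 Nn nR n2} n => [|n IH]; first by rewrite big_ord0 expr0n /= subrr !mulr0.
  rewrite big_ord_recr /= natrD -[n.+1%:R]natr1; have := D_lower n; move: IH; set s : R := (\sum_(j < n) D j)%:R.
  have -> : C * ((n%:R + 1) ^+ 2 - (n%:R + 1)) = C * (n%:R ^+ 2 - n%:R) + 2 * (C * n%:R) by ring.
  by lra.
have up : 2 * (\sum_(j < n) D j)%:R <= (C + e) * (n%:R ^+ 2 - n%:R) + 2 * K * n%:R.
  elim: {n0 Nn nR n2 lo} n => [|n IH]; first by rewrite big_ord0 expr0n /= subrr !mulr0 addr0.
  rewrite big_ord_recr /= natrD -[n.+1%:R]natr1; have := HK n; move: IH; set s : R := (\sum_(j < n) D j)%:R.
  have -> : (C + e) * ((n%:R + 1) ^+ 2 - (n%:R + 1)) + 2 * K * (n%:R + 1) =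
     (C + e) * (n%:R ^+ 2 - n%:R) + 2 * K * n%:R + 2 * ((C + e) * n%:R + K) by ring.
  by lra.
rewrite -(ler_pM2r n2) -[X in _ * X <= _](ger0_norm (ltW n2)) -normrM mulrBl divfK ?gt_eqF //.
have Kn : (`|K| * 2 + C) * n%:R <= e * n%:R ^+ 2.
  by rewrite expr2 mulrA ler_pM2r // HN.
have KK : K * n%:R <= `|K| * n%:R by rewrite ler_pM2r // ler_norm.
have K0 : 0 <= `|K| * n%:R by rewrite mulr_ge0 // ltW.
have Cn : 0 <= C * n%:R by rewrite mulr_ge0 // ltW.
have en : 0 <= e * n%:R by rewrite mulr_ge0 // ltW.
by rewrite ler_norml; apply/andP; split; lra.
Qed.

End GrowthOfCounts.

Section WeightGrowth.
Variables (R : realType) (C : R) (b : nat -> nat).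
Hypothesis C0 : 0 <= C.
Hypothesis b0_gt0 : (0 < b 0)%N.
Hypothesis b_double : forall i, ((b i).*2 < b i.+1)%N.
Hypothesis b_le : forall i, C * (b i)%:R <= 2 ^+ i - C.
Hypothesis b_ge : forall e, 0 < e -> exists i0, forall i, (i0 <= i)%N -> 2 ^+ i <= (C + e) * (b i)%:R.
Local Notation D := (wcount b0_gt0 b_double).
Local Notation w := (weight b).

Lemma natr_bigbit (F : nat -> nat) m n : (m <= n)%N ->
  (bigbit addn F m)%:R = \sum_(i < n | bit m i) (F i)%:R :> R.
Proof. by move=> mn; rewrite (bigbit_widen _ _ mn) natr_sum. Qed.

Lemma natr_binary m n : (m <= n)%N -> m%:R = \sum_(i < n | bit m i) 2 ^+ i :> R.
Proof.
by move=> mn; rewrite -{1}(bigbit_nat m) (natr_bigbit _ mn); apply: eq_bigr => i _; rewrite natrX.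
Qed.

Lemma weight_upper m : C * (w m)%:R <= m%:R - C * (bigbit addn (fun=> 1%N) m)%:R.
Proof.
rewrite (natr_binary (leqnn m)) /weight !(natr_bigbit _ (leqnn m)) !big_distrr /= -sumrB.
by apply: ler_sum => i _; rewrite mulr1.
Qed.

(** Digits from i0 on obey [b_ge]; the finitely many below it contribute at most the constant K. *)
Lemma weight_lower e : 0 < e -> exists K, forall m, m%:R <= (C + e) * (w m)%:R + K.
Proof.
move=> e0; have [i0 H] := b_ge e0; exists (\sum_(i < i0) 2 ^+ i) => m.
rewrite (natr_binary (leq_maxl m i0)) /weight (natr_bigbit _ (leq_maxl m i0)).
have -> : \sum_(i < i0) 2 ^+ i = \sum_(i < maxn m i0 | (i < i0)%N) 2 ^+ i :> R.
  by rewrite (big_ord_widen _ (fun i => 2 ^+ i) (leq_maxr m i0)).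
rewrite big_distrr /= big_mkcond [X in _ <= X + _]big_mkcond [X in _ <= _ + X]big_mkcond -big_split.
apply: ler_sum => i _ /=; have Ce : 0 <= C + e by rewrite addr_ge0 // ltW.
have b1 : 0 <= (C + e) * (b i)%:R by rewrite mulr_ge0.
have p0 : 0 <= 2 ^+ i :> R by rewrite exprn_ge0.
case: ifP => _; case: ltnP => ii; rewrite ?addr0 ?add0r ?lerDr //; exact: H.
Qed.

(** [D n] is the first m whose weight exceeds n, so C n <= C w(D n) <= D n. *)
Lemma wcount_lower n : C * n%:R <= (D n)%:R.
Proof.
have lt : (n < w (D n))%N by rewrite ltnNge weight_leq ltnn.
apply: (@le_trans _ _ (C * (w (D n))%:R)); first by rewrite ler_wpM2l // ler_nat ltnW.
apply: le_trans (weight_upper _) _; rewrite gerBl mulr_ge0 //.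
Qed.

Lemma wcount_upper e : 0 < e -> exists K, forall n, (D n)%:R <= (C + e) * n%:R + K.
Proof.
move=> e0; have [K H] := weight_lower e0; exists (K + 1) => n.
have := wcount_gt0 b0_gt0 b_double n; case E : (D n) => [//|m] _.
have wn : (w m <= n)%N by rewrite (weight_leq b0_gt0 b_double) E.
rewrite -natr1 addrA lerD2r; apply: le_trans (H m) _; rewrite lerD2r.
by rewrite ler_wpM2l ?ler_nat // addr_ge0 // ltW.
Qed.

(** Test at n = w(2^k - 1), where D n = 2^k. All k digits equal 1, so C n <= 2^k - 1 - C k and the
    error is at least 1 + C k. For C = 0 the error is D n = 2^k itself. *)
Lemma wcount_unbounded B : exists n, B < (D n)%:R - C * n%:R.
Proof.
have [k Hk] : exists k : nat, B < ((2 ^ k).-1).+1%:R - (if C == 0 then 0 else (2 ^ k).-1%:R - C * k%:R).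
  case: (eqVneq C 0) => [_|Cn0].
    have [k Hk] := nat_bound B; exists k; rewrite subr0 prednK ?expn_gt0 //.
    by apply: le_lt_trans Hk _; rewrite ltr_nat ltn_expl.
  have Cp : 0 < C by rewrite lt_neqAle eq_sym Cn0.
  have [k Hk] := div_small B Cp; exists k; have := Hk k (leqnn k).
  by rewrite -natr1; lra.
exists (w (2 ^ k).-1); rewrite wcount_weight.
have := weight_upper (2 ^ k).-1; rewrite bigbit_pred_pow2 sum1_card card_ord.
by move: Hk; case: eqVneq => [->|_]; rewrite ?mul0r; lra.
Qed.

End WeightGrowth.

(** * Choice of the exponents *)

Section ExponentSequence.
Variables (R : realType) (C : R).
Hypothesis hC : 0 <= C <= 1 / 2.

Lemma exponent_sequence : exists b : nat -> nat,
  [/\ (0 < b 0)%N, forall i, ((b i).*2 < b i.+1)%N,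
      forall i, C * (b i)%:R <= 2 ^+ i - C
    & forall e, 0 < e -> exists i0, forall i, (i0 <= i)%N -> 2 ^+ i <= (C + e) * (b i)%:R].
Proof.
have [C0|Cn0] := eqVneq C 0.
  (* For C = 0 the extra factor i + 2 drives 2^i / b_i to 0. *)
  exists (fun i => (2 ^ i * i.+2).-1); split=> [//|i|i|e e0].
  - have : (0 < 2 ^ i)%N by rewrite expn_gt0.
    by rewrite expnS; nia.
  - by rewrite C0 mul0r subr0 exprn_ge0.
  have [N HN] := div_small 1 e0; exists N => i Ni; rewrite C0 add0r.
  have bi : ((2 ^ i * i.+1)%N <= (2 ^ i * i.+2).-1)%N.
    have : (0 < 2 ^ i)%N by rewrite expn_gt0.
    by nia.
  apply: (@le_trans _ _ (e * (2 ^ i * i.+1)%N%:R)); last by rewrite ler_pM2l // ler_nat.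
  rewrite natrM natrX mulrCA -[X in X <= _]mulr1 ler_pM2l ?exprn_gt0 //.
  by apply: HN; exact: leqW.
have Cp : 0 < C by case/andP: hC => h _; rewrite lt_neqAle eq_sym Cn0.
pose T i := Num.truncn (2 ^+ i / C).
have T0 i : 0 <= 2 ^+ i / C by rewrite divr_ge0 ?exprn_ge0 // ltW.
have Tle i : (T i)%:R <= 2 ^+ i / C by rewrite truncn_le.
have Tlt i : 2 ^+ i / C < (T i).+1%:R by case/andP: (truncn_itv (T0 i)).
have T2 i : ((T i).*2 <= T i.+1)%N.
  rewrite -ltnS -(ltr_nat R); apply: le_lt_trans (Tlt i.+1).
  by rewrite -muln2 natrM mulrC exprS -mulrA ler_pM2l.
(* This is where C <= 1/2 is used. *)
have T02 : (2 <= T 0)%N.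
  rewrite -ltnS -(ltr_nat R); apply: le_lt_trans (Tlt 0%N).
  by rewrite expr0 ler_pdivlMr //; case/andP: hC; lra.
have Tge i : (2 <= T i)%N by elim: i => // i IH; have := T2 i; lia.
(* Subtracting 1 makes the doubling strict, as 2(T - 1) < 2T - 1, and leaves in the upper bound on C
   b_i the surplus C that each binary digit 1 contributes to the error. *)
exists (fun i => (T i).-1); split=> [|i|i|e e0].
- by have := T02; lia.
- by have := T2 i; have := Tge i; lia.
- have -> : (T i).-1%:R = (T i)%:R - 1 :> R.
    by rewrite -[in RHS](prednK (ltnW (Tge i))) -natr1 addrK.
  rewrite mulrBr mulr1 lerD2r mulrC -ler_pdivlMr //.
have eC : 0 < e / C by rewrite divr_gt0.
have [N HN] := div_small (2 * (C + e)) eC; exists N => i Ni.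
have -> : (T i).-1%:R = (T i)%:R - 1 :> R.
  by rewrite -[in RHS](prednK (ltnW (Tge i))) -natr1 addrK.
have t : 2 ^+ i / C - 2 <= (T i)%:R - 1 by have := Tlt i; rewrite -natr1; lra.
apply: (@le_trans _ _ ((C + e) * (2 ^+ i / C - 2))); last by rewrite ler_wpM2l // addr_ge0 // ltW.
have -> : (C + e) * (2 ^+ i / C - 2) = 2 ^+ i + (e / C * 2 ^+ i - 2 * (C + e)).
  by field; rewrite gt_eqF.
rewrite lerDl subr_ge0; apply: le_trans (HN i Ni) _; rewrite ler_pM2l //.
by rewrite -natrX ler_nat ltnW // ltn_expl.
Qed.

End ExponentSequence.

Theorem theorem1p4 (R : realType) (C : R) (hC : 0 <= C <= 1 / 2) :
  exists (A : idomainType) (m : set A) (nu : discrete_valuation {fraction A})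
    (dom : dominates m nu),
    regular_local_ring m 2 /\
    ~ quasi_polynomial_plus_bounded (length_quotient dom R) /\
    ~ quasi_polynomial_plus_bounded (length_graded dom R) /\
    ((length_graded dom R n * (n%:R^-1)%:E)%E @[n --> \oo] --> C%:E) /\
    ((length_quotient dom R n * ((n%:R ^+ 2)^-1)%:E)%E @[n --> \oo]
       --> (C / 2)%:E).
Proof.
have [b [b0_gt0 b_double b_le b_ge]] := exponent_sequence hC.
have /andP[C0 _] := hC.
have [A [m [nu [dom [reg len]]]]] := @plane_valuation_lengths rat R (@ratr R)
  (fun i => (prime_seq i)%:R) (radical R) (radical_sqr R) (@radical_prod_free R) b b0_gt0 b_double.
exists A, m, nu, dom; split=> //.
have lenG n := (len R n).1; have lenQ n := (len R n).2.
have Dmono := @leq_wcount _ b0_gt0 b_double.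
have Dlo := wcount_lower C0 b0_gt0 b_double b_le.
have Dup := wcount_upper C0 b0_gt0 b_double b_ge.
have Dub := wcount_unbounded C0 b0_gt0 b_double b_le.
split; first exact: (count_sum_not_quasi_poly C0 Dmono Dlo Dup Dub).
split; first exact: (count_not_quasi_poly C0 Dmono Dlo Dup Dub).
split.
  have -> : length_graded dom R = fun n => (wcount b0_gt0 b_double n)%:R%:E by apply/funext.
  exact: count_cvg.
have -> : length_quotient dom R = fun n => (\sum_(j < n) wcount b0_gt0 b_double j)%:R%:E by apply/funext.
exact: count_sum_cvg.
Qed.
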